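(* Let $L,C_\parallel,C_\perp>0$, $\gamma_1,\gamma_2>0$, $\theta^\circ\in[0,2\pi)$, $x_1^\circ,x_2^\circ\in\mathbb{R}^2$, and let $\lambda\in(0,1)$ be such that the matrix $\mathcal R(\theta_1,\theta_2,\sigma_1,\sigma_2;\lambda)$ defined in the context is invertible for all $(\theta_1,\theta_2,\sigma_1,\sigma_2)\in\mathbb{R}^4$. For $\phi\in\mathbb{R}$, $\varepsilon>0$ and $\tau>0$, let $z=(\mathbf x_1,\theta_1,\mathbf x_2,\theta_2,\sigma_1,\sigma_2):[0,4\tau]\to\mathbb{R}^8$ be the solution of the control system $$\dot z=v_1(\theta_1,\theta_2,\sigma_1,\sigma_2;\lambda)\,u_1(t)+v_2(\theta_1,\theta_2,\sigma_1,\sigma_2;\lambda)\,u_2(t)$$ with initial datum $z(0)=(x_1^\circ,\theta^\circ,x_2^\circ,\theta^\circ,\pi+\varepsilon,\pi+\varepsilon\cos\phi)$ and controls $(u_1,u_2)=(0,-\gamma_2)$ on $[0,\tau)$, $(-\gamma_1,0)$ on $[\tau,2\tau)$, $(0,\gamma_2)$ on $[2\tau,3\tau)$, $(\gamma_1,0)$ on $[3\tau,4\tau)$. Let $$\delta_m(\phi;\varepsilon,\tau)=\left|\frac{\mathbf x_1(4\tau)+\mathbf x_2(4\tau)}{2}-\frac{x_1^\circ+x_2^\circ}{2}\right|$$ be the net displacement of the midpoint of the two hinges. Then the maximal displacement, to leading order, is obtained for the phase difference $\phi=\pi/2$: the leading-order displacement coefficient $$D(\phi)=\lim_{\varepsilon\to0^+}\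 \lim_{\tau\to0^+}\frac{\delta_m(\phi;\varepsilon,\tau)}{\varepsilon^2\tau^2}$$ exists for every $\phi\in\mathbb{R}$, and $D$ attains its maximum over $\phi\in\mathbb{R}$ at $\phi=\pi/2$.
   Context: The state is $z=(\mathbf x_1,\theta_1,\mathbf x_2,\theta_2,\sigma_1,\sigma_2)\in\mathbb{R}^8$, where $\mathbf x_i\in\mathbb{R}^2$ is the hinge position, $\theta_i$ the orientation and $\sigma_i$ the opening angle of the $i$-th of two hydrodynamically interacting scallops (two links of length $L$ each; drag coefficients $C_\parallel,C_\perp$; interaction parameter $\lambda$, treated as a constant). For $v=(a,b)^\top\in\mathbb{R}^2$ write $v^\perp=(-b,a)^\top$; put $\neg i=3-i$. For $i,j\in\{1,2\}$ let $$e_i^{(j)}=\big(\cos(\theta_i+(j-1)\sigma_i),\ \sin(\theta_i+(j-1)\sigma_i)\big)^\top,\qquad E_i^{(j)}=e_i^{(j)}(e_i^{(j)})^\top,$$ $$A_i=L\big[2C_\perp I+(C_\parallel-C_\perp)(E_i^{(1)}+E_i^{(2)})\big],\quad b_i=\tfrac{L^2}{2}C_\perp\big(e_i^{(1)}+e_i^{(2)}\big)^\perp,\quad \alpha_i=\tfrac{L^2}{2}C_\perp\big(e_i^{(2)}\big)^\perp,$$ $$d_i=\tfrac{L^2(C_\parallel-C_\perp)}{2}\Big[\big((e_i^{(1)})^\perp\cdot e_{\neg i}^{(1)}\big)e_{\neg i}^{(1)}+\big((e_i^{(2)})^\perp\cdot e_{\neg i}^{(2)}\big)e_{\neg i}^{(2)}\Big]+b_i,$$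 $$\omega=\tfrac{2L^3C_\perp}{3},\quad \varpi=\tfrac{L^3C_\perp}{3}\big[e_1^{(1)}\cdot e_2^{(1)}+e_1^{(2)}\cdot e_2^{(2)}\big],\quad \beta=\tfrac{L^3C_\perp}{3}\,e_1^{(2)}\cdot e_2^{(2)}.$$ Then $$\mathcal R=\begin{pmatrix}A_1&b_1&-\lambda A_2&-\lambda b_2\\ b_1^\top&\omega&-\lambda d_1^\top&-\lambda\varpi\\ -\lambda A_1&-\lambda b_1&A_2&b_2\\ -\lambda d_2^\top&-\lambda\varpi&b_2^\top&\omega\end{pmatrix}\in\mathbb{R}^{6\times6},\quad \phi_1=\begin{pmatrix}\alpha_1\\ \omega/2\\ -\lambda\alpha_1\\ -\lambda\beta\end{pmatrix},\quad \phi_2=\begin{pmatrix}-\lambda\alpha_2\\ -\lambda\beta\\ \alpha_2\\ \omega/2\end{pmatrix}\in\mathbb{R}^6,$$ and the control vector fields on $\mathbb{R}^8$ are $$v_1=\begin{pmatrix}-\mathcal R^{-1}\phi_1\\ 1\\ 0\end{pmatrix},\qquad v_2=\begin{pmatrix}-\mathcal R^{-1}\phi_2\\ 0\\ 1\end{pmatrix},$$ all functions of $(\theta_1,\theta_2,\sigma_1,\sigma_2)$ and of the parameter $\lambda$. (The vectors $\phi_1,\phi_2$ are unrelated to the phase $\phi$.) *)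

(* Defs.v *)
From HB Require Import structures.
From mathcomp Require Import all_boot all_order all_algebra.
From mathcomp Require Import all_classical all_reals all_analysis.
Set Implicit Arguments.
Unset Strict Implicit.
Unset Printing Implicit Defensive.
Import Order.TTheory GRing.Theory Num.Theory.
Import numFieldNormedType.Exports.
Local Open Scope classical_set_scope.
Local Open Scope ring_scope.

(* The scallop labels i and the link labels j, which run over {1, 2} in the
   usual notation, are elements 0, 1 of 'I_2; rev_ord exchanges the two
   scallops, and link j makes the angle theta i + j * sigma i.  *)

Section Plane.
Variable R : realType.
Implicit Types (a b : R) (u v : 'cV[R]_2).

Definition vec2 a b : 'cV[R]_2 := \col_(k < 2) (if k == 0 then a else b).

Definition perp v : 'cV[R]_2 := vec2 (- v 1 0) (v 0 0).

Definition dot u v : R := \sum_(k < 2) u k 0 * v k 0.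

(* The norm `|v| of the library on matrices is the sup norm.  *)
Definition enorm v : R := Num.sqrt (dot v v).

End Plane.

(* (x_1, theta_1, x_2, theta_2, sigma_1, sigma_2) in R^8.  *)
Notation state R := 'cV[R]_(((2 + 1) + (2 + 1)) + (1 + 1)).

Section State.
Variable R : realType.
Implicit Types (z : state R) (i : 'I_2).

Definition mk_state (x1 : 'cV[R]_2) (theta1 : R) (x2 : 'cV[R]_2) (theta2 : R)
    (sigma1 sigma2 : R) : state R :=
  col_mx (col_mx (col_mx x1 theta1%:M) (col_mx x2 theta2%:M))
         (col_mx sigma1%:M sigma2%:M).

Definition scallop z i : 'cV[R]_(2 + 1) :=
  if i == 0 then usubmx (usubmx z) else dsubmx (usubmx z).

Definition hinge z i : 'cV[R]_2 := usubmx (scallop z i).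

Definition orientation z i : R := dsubmx (scallop z i) 0 0.

Definition opening z i : R := dsubmx z i 0.

End State.

Section Hydrodynamics.
Variables (R : realType) (L Cpar Cperp lam : R) (theta sigma : 'I_2 -> R).
Implicit Types i j k : 'I_2.

Definition link i j : 'cV[R]_2 :=
  vec2 (cos (theta i + j%:R * sigma i)) (sin (theta i + j%:R * sigma i)).

Definition link_proj i j : 'M[R]_2 := link i j *m (link i j)^T.

Definition Acoef i : 'M[R]_2 :=
  L *: ((2 * Cperp)%:M
        + (Cpar - Cperp) *: (link_proj i 0 + link_proj i 1)).

Definition bcoef i : 'cV[R]_2 :=
  (L ^+ 2 / 2 * Cperp) *: perp (link i 0 + link i 1).

Definition alphacoef i : 'cV[R]_2 := (L ^+ 2 / 2 * Cperp) *: perp (link i 1).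

Definition dcoef i : 'cV[R]_2 :=
  let n := rev_ord i in
  (L ^+ 2 * (Cpar - Cperp) / 2)
    *: (dot (perp (link i 0)) (link n 0) *: link n 0
        + dot (perp (link i 1)) (link n 1) *: link n 1)
  + bcoef i.

Definition omega : R := 2 * L ^+ 3 * Cperp / 3.

Definition varpi : R :=
  L ^+ 3 * Cperp / 3 * (dot (link 0 0) (link 1 0) + dot (link 0 1) (link 1 1)).

Definition betacoef : R := L ^+ 3 * Cperp / 3 * dot (link 0 1) (link 1 1).

Definition resistance : 'M[R]_((2 + 1) + (2 + 1)) :=
  block_mx
    (block_mx (Acoef 0) (bcoef 0) (bcoef 0)^T omega%:M)
    (block_mx (- lam *: Acoef 1) (- lam *: bcoef 1)
              (- lam *: (dcoef 0)^T) (- lam * varpi)%:M)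
    (block_mx (- lam *: Acoef 0) (- lam *: bcoef 0)
              (- lam *: (dcoef 1)^T) (- lam * varpi)%:M)
    (block_mx (Acoef 1) (bcoef 1) (bcoef 1)^T omega%:M).

Definition shape_force k : 'cV[R]_((2 + 1) + (2 + 1)) :=
  let self := col_mx (alphacoef k) (omega / 2)%:M in
  let other := col_mx (- lam *: alphacoef k) (- lam * betacoef)%:M in
  if k == 0 then col_mx self other else col_mx other self.

Definition control_field k : state R :=
  col_mx (- (invmx resistance *m shape_force k)) (delta_mx k 0).

End Hydrodynamics.

Section Dynamics.
Variables (R : realType) (L Cpar Cperp lam gamma1 gamma2 : R).
Variables (theta0 : R) (x1o x2o : 'cV[R]_2).

Definition control1 (tau t : R) : R :=
  if tau <= t < 2 * tau then - gamma1
  else if 3 * tau <= t < 4 * tau then gamma1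
  else 0.

Definition control2 (tau t : R) : R :=
  if 0 <= t < tau then - gamma2
  else if 2 * tau <= t < 3 * tau then gamma2
  else 0.

Definition velocity (tau t : R) (y : state R) : state R :=
  let v := control_field L Cpar Cperp lam (orientation y) (opening y) in
  control1 tau t *: v 0 + control2 tau t *: v 1.

(* The controls jump at tau, 2 tau and 3 tau: a solution on [0, 4 tau] is a
   continuous function satisfying the equation off these instants.  The values
   of z outside [0, 4 tau] are irrelevant.  *)
Definition is_solution (phi eps tau : R) (z : R -> state R) : Prop :=
  [/\ z 0 = mk_state x1o theta0 x2o theta0 (pi + eps) (pi + eps * cos phi),
      {within `[0, 4 * tau], continuous z}
    & forall t, 0 < t < 4 * tau -> t != tau -> t != 2 * tau -> t != 3 * tau ->
        is_derive t 1 z (velocity tau t (z t))].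

Definition midpoint_displacement (tau : R) (z : R -> state R) : R :=
  enorm (2^-1 *: (hinge (z (4 * tau)) 0 + hinge (z (4 * tau)) 1)
         - 2^-1 *: (x1o + x2o)).

End Dynamics.

Section LeadingOrder.
Variables (R : realType) (x1o x2o : 'cV[R]_2).
(* z phi eps tau is the trajectory for the given phase, amplitude, duration. *)
Variable z : R -> R -> R -> R -> state R.

Definition scaled_displacement (phi eps tau : R) : R :=
  midpoint_displacement x1o x2o tau (z phi eps tau) / (eps ^+ 2 * tau ^+ 2).

Definition small_time_limit (phi eps : R) : R :=
  lim (scaled_displacement phi eps tau @[tau --> 0^'+]).

(* lim is total: that the two limits exist has to be asserted separately.  *)
Definition displacement_coefficient (phi : R) : R :=
  lim (small_time_limit phi eps @[eps --> 0^'+]).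

End LeadingOrder.

(* Main.v *)
Require Import Defs.
From HB Require Import structures.
From mathcomp Require Import all_boot all_order all_algebra.
From mathcomp Require Import ring lra.
From mathcomp Require Import all_classical all_reals all_analysis.
Import Order.TTheory GRing.Theory Num.Theory.
Import numFieldNormedType.Exports.
Local Open Scope classical_set_scope.
Local Open Scope ring_scope.

Set Implicit Arguments.
Unset Strict Implicit.
Unset Printing Implicit Defensive.

(* Forces decouple: the total force on each scallop vanishes, so that hinge i
   moves by thrust * (opening rate) along the axis of the scallop and by
   drift * (rotation rate) across it.  The two torque equations then form a
   2 x 2 system for the rotation rates, whose right-hand side carries the factor
   tilt, the sine of the angle between the axes.  The displacement over the loop
   is tau^2 times the commutator of the two control fields, up to o(tau^2).
   At the straight configuration drift, tilt and the rotation coefficients turn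
   all vanish, and the axes are turned by half the opening, so the commutator
   is of second order in eps; being antisymmetric under the exchange of the
   scallops, it is C * (s_2^2 - s_1^2) for the perturbations s_1 = eps and
   s_2 = eps cos phi.  Hence D(phi) = D(pi/2) * sin^2 phi.  *)

(** * Increments over the loop of controls *)

(** The resistance matrix is never inverted explicitly. In the basis of axis and normal its drag
    blocks are diagonal, so velocities free of force and torque can be written down and checked by
    multiplication; invertibility then cancels the matrix, and it also shows that the torque system
    is nonsingular. The increment over the loop comes from the mean value theorem, applied to a
    quantity and to its rate. This requires the second-order rates to stay close to their initial
    values over the whole loop. Trajectories for different [tau] are unrelated functions, so
    continuity of each one is not enough: a bound on the rotation rates independent of [tau] is
    needed, although the orientations range over a noncompact set. Since the limit in [tau] is taken
    first, only the commutator at the exact initial configuration is expanded in [eps]. The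
    Euclidean norm is recovered from the projections on the directions [zeta = 0] and
    [zeta = pi / 2]. Each has its own constant C, of which only the square enters the comparison. *)

Section Loop.
Variable R : realType.
Implicit Types (f d e : R -> R) (a b s t tau w m eta : R).

Lemma within_segment_sub f a b a' b' : a <= a' -> b' <= b ->
  {within `[a, b], continuous f} -> {within `[a', b'], continuous f}.
Proof.
move=> aa' bb'; apply: continuous_subspaceW => t /=.
by rewrite !in_itv /= => /andP[h1 h2]; rewrite (le_trans aa')// (le_trans h2).
Qed.

Lemma increment_bound f d a b m eta : a <= b ->
  {within `[a, b], continuous f} ->
  (forall t, a < t < b -> is_derive t 1 f (d t)) ->
  (forall t, a < t < b -> `|d t - m| <= eta) ->
  `|f b - f a - m * (b - a)| <= eta * (b - a).
Proof.
move=> ab cf df hd; move: ab; rewrite [a <= b]le_eqVlt => /predU1P[->|ab].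
  by rewrite !subrr !mulr0 subr0 normr0.
have {}df t : t \in `]a, b[ -> is_derive t 1 f (d t).
  by rewrite in_itv /=; exact: df.
have [t tab ->] := MVT ab df cf.
rewrite -mulrBl normrM [`|b - a|]ger0_norm; last by rewrite subr_ge0 ltW.
apply: ler_wpM2r; first by rewrite subr_ge0 ltW.
by apply: hd; move: tab; rewrite in_itv.
Qed.

(** A Taylor expansion by two uses of the mean value theorem: the rate [c] is affine up to [eta],
    and then the quadratic polynomial is subtracted from [f]. *)
Lemma leg_expansion f c e s tau w m eta : 0 < tau ->
  {within `[s, s + tau], continuous f} ->
  {within `[s, s + tau], continuous c} ->
  (forall t, s < t < s + tau -> is_derive t 1 f (w * c t)) ->
  (forall t, s < t < s + tau -> is_derive t 1 c (w * e t)) ->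
  (forall t, s < t < s + tau -> `|e t - m| <= eta) ->
  `|f (s + tau) - f s - w * c s * tau - w ^+ 2 * m * tau ^+ 2 / 2|
    <= w ^+ 2 * eta * tau ^+ 2.
Proof.
move=> tau0 cf cc df dc he.
have we t : s < t < s + tau -> `|w * e t - w * m| <= `|w| * eta.
  by move=> /he; rewrite -mulrBr normrM => h; rewrite ler_wpM2l.
have eta0 : 0 <= eta.
  by apply: le_trans (normr_ge0 _) (he (s + tau / 2) _); lra.
have hc t : s < t < s + tau ->
    `|w * (c t - c s - w * m * (t - s)) - 0| <= w ^+ 2 * eta * tau.
  move=> /andP[st ts]; rewrite subr0 normrM.
  have /(_ (`|w| * eta))  := @increment_bound c (fun t => w * e t) s t (w * m).
  have -> : w ^+ 2 * eta * tau = `|w| * (`|w| * eta * tau).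
    by rewrite -(real_normK (num_real w)); ring.
  move=> h; apply: ler_wpM2l => //; apply: (le_trans (h _ _ _ _)).
  - exact: ltW.
  - by apply: within_segment_sub cc => //; exact: ltW.
  - by move=> r /andP[sr rt]; apply: dc; rewrite sr (lt_trans rt).
  - by move=> r /andP[sr rt]; apply: we; rewrite sr (lt_trans rt).
  - by apply: ler_wpM2l; rewrite ?mulr_ge0//; lra.
pose k t := f t - (w * c s * (t - s) + w ^+ 2 * m * (t - s) ^+ 2 / 2).
have ck : {within `[s, s + tau], continuous k}.
  have ck : {within `[s, s + tau],
      continuous (fun t => w * c s * (t - s) + w ^+ 2 * m * (t - s) ^+ 2 / 2)}.
    apply: continuous_subspaceT => t.
    have cs : (fun t => t - s) @ t --> t - s.
      by apply: cvgB; [exact: cvg_id|exact: cvg_cst].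
    apply: cvgD; first by apply: cvgM => //; exact: cvg_cst.
    apply: cvgM; last exact: cvg_cst.
    by apply: cvgM; [exact: cvg_cst|exact: cvgM].
  by move=> t; apply: cvgB; [exact: cf|exact: ck].
have dk t : s < t < s + tau ->
    is_derive t 1 k (w * (c t - c s - w * m * (t - s))).
  move=> st; have h1 := df t st.
  apply: is_derive_eq.
  by rewrite /GRing.scale /=; field.
have s1 : s <= s + tau by lra.
have -> : w ^+ 2 * eta * tau ^+ 2 = w ^+ 2 * eta * tau * (s + tau - s) by ring.
have := increment_bound s1 ck dk hc.
congr (`|_| <= _); rewrite /k; by field.
Qed.

(** [a] and [b] are the amplitudes of the first and second control, and [c j] is the rate of [f] per
    unit of control [j]. Nothing but continuity is asked at the switching instants. *)
Definition follows_loop a b tau f (c : 'I_2 -> R -> R) : Prop :=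
  {within `[0, 4 * tau], continuous f} /\
  [/\ forall t, 0 < t < tau -> is_derive t 1 f (- b * c 1 t),
    forall t, tau < t < 2 * tau -> is_derive t 1 f (- a * c 0 t),
    forall t, 2 * tau < t < 3 * tau -> is_derive t 1 f (b * c 1 t)
  & forall t, 3 * tau < t < 4 * tau -> is_derive t 1 f (a * c 0 t)].

Lemma ler_norm4 (x1 x2 x3 x4 : R) :
  `|x1 + x2 + x3 + x4| <= `|x1| + `|x2| + `|x3| + `|x4|.
Proof.
apply: le_trans (ler_normD _ _) _; rewrite lerD2r.
apply: le_trans (ler_normD _ _) _; rewrite lerD2r.
exact: ler_normD.
Qed.

(** [m k j] approximates the derivative of the rate [c k] along field [j]. The diagonal terms of the
    four expansions cancel against the change of each rate between the two legs that it drives; the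
    off-diagonal ones leave the commutator. *)
Lemma loop_increment a b tau f (c : 'I_2 -> R -> R)
    (e : 'I_2 -> 'I_2 -> R -> R) (m : 'I_2 -> 'I_2 -> R) eta :
  0 <= a -> 0 <= b -> 0 < tau ->
  follows_loop a b tau f c ->
  (forall k, follows_loop a b tau (c k) (e k)) ->
  (forall k j t, 0 <= t <= 4 * tau -> `|e k j t - m k j| <= eta) ->
  `|f (4 * tau) - f 0 - a * b * (m 0 1 - m 1 0) * tau ^+ 2|
    <= 3 * (a + b) ^+ 2 * eta * tau ^+ 2.
Proof.
move=> a0 b0 tau0.
have [s1 s2 s3] : [/\ 0 <= tau, 0 <= 2 * tau & 0 <= 3 * tau] by split; lra.
have [q1 q2 q3] : [/\ tau <= 4 * tau, 2 * tau <= 4 * tau & 3 * tau <= 4 * tau].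
  by split; lra.
have [q4 q5] : 0 <= (0 : R) <= 4 * tau /\ 4 * tau <= 4 * tau by split; lra.
have s0 : 0 <= (0 : R) by [].
move=> [cf [f1 f2 f3 f4]] hc he.
have cc k : {within `[0, 4 * tau], continuous (c k)} by case: (hc k).
have sub (g : R -> R) (s s' : R) : 0 <= s -> s' <= 4 * tau ->
    {within `[0, 4 * tau], continuous g} -> {within `[s, s'], continuous g}.
  by move=> h0 s4 cg; exact: (within_segment_sub h0 s4 cg).
have heb s s' k j t : 0 <= s -> s' <= 4 * tau -> s < t < s' ->
    `|e k j t - m k j| <= eta.
  by move=> z0 s4 /andP[? ?]; apply: he; lra.
have inc k j s w : 0 <= s -> s + tau <= 4 * tau ->
    (forall t, s < t < s + tau -> is_derive t 1 (c k) (w * e k j t)) ->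
    `|c k (s + tau) - c k s - w * m k j * tau| <= `|w| * eta * tau.
  move=> h0 s4 dc; have ss : s <= s + tau by lra.
  have hw t : s < t < s + tau -> `|w * e k j t - w * m k j| <= `|w| * eta.
    move=> ht; rewrite -mulrBr normrM; apply: ler_wpM2l => //.
    exact: heb ht.
  have := increment_bound ss (sub _ _ _ h0 s4 (cc k)) dc hw.
  by rewrite [s + tau - s]addrC addKr.
have leg j s w : 0 <= s -> s + tau <= 4 * tau ->
    (forall t, s < t < s + tau -> is_derive t 1 f (w * c j t)) ->
    (forall t, s < t < s + tau -> is_derive t 1 (c j) (w * e j j t)) ->
    `|f (s + tau) - f s - w * c j s * tau - w ^+ 2 * m j j * tau ^+ 2 / 2|
      <= w ^+ 2 * eta * tau ^+ 2.
  move=> h0 s4 df dc.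
  apply: (leg_expansion tau0 (sub _ _ _ h0 s4 cf) (sub _ _ _ h0 s4 (cc j)) df dc).
  by move=> t; exact: heb.
have [E1 E2 E3 E4] : [/\ 0 + tau = tau, tau + tau = 2 * tau,
    2 * tau + tau = 3 * tau & 3 * tau + tau = 4 * tau] by split; ring.
have [_ [c01 c02 c03 _]] := hc 0; have [_ [c11 c12 c13 _]] := hc 1.
have c04 : forall t, 3 * tau < t < 4 * tau -> is_derive t 1 (c 0) (a * e 0 0 t).
  by case: (hc 0) => _ [].
have l1 := leg 1 0 (- b); have l2 := leg 0 tau (- a).
have l3 := leg 1 (2 * tau) b; have l4 := leg 0 (3 * tau) a.
have i1 := inc 1 1 0 (- b); have i2 := inc 1 0 tau (- a).
have i3 := inc 0 0 tau (- a); have i4 := inc 0 1 (2 * tau) b.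
rewrite E1 in l1 i1; rewrite E2 in l2 i2 i3; rewrite E3 in l3 i4; rewrite E4 in l4.
have {}l1 := l1 s0 q1 f1 c11.
have {}l2 := l2 s1 q2 f2 c02.
have {}l3 := l3 s2 q3 f3 c13.
have {}l4 := l4 s3 q5 f4 c04.
have {}i1 := i1 s0 q1 c11.
have {}i2 := i2 s1 q2 c12.
have {}i3 := i3 s1 q2 c02.
have {}i4 := i4 s2 q3 c03.
rewrite normrN (ger0_norm a0) in i2 i3; rewrite normrN (ger0_norm b0) in i1.
rewrite (ger0_norm b0) in i4.
have scale w x y : 0 <= w -> `|x| <= y -> `|w * tau * x| <= w * tau * y.
  by move=> w0 h; rewrite normrM ger0_norm; [apply: ler_wpM2l|]; rewrite ?mulr_ge0// ltW.
have {}i1 := scale _ _ _ b0 i1; have {}i2 := scale _ _ _ b0 i2.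
have {}i3 := scale _ _ _ a0 i3; have {}i4 := scale _ _ _ a0 i4.
have eta0 : 0 <= eta by exact: le_trans (normr_ge0 _) (he 0 0 0 q4).
(* An exact decomposition: the remainders of the four legs, then those of the change of [c 1] from 0
   to [2 * tau] and of [c 0] from [tau] to [3 * tau], each split at the switching instant
   between. *)
rewrite [leLHS](_ : _ = `|((f tau - f 0 - - b * c 1 0 * tau - (- b) ^+ 2 * m 1 1 * tau ^+ 2 / 2)
 + (f (2 * tau) - f tau - - a * c 0 tau * tau - (- a) ^+ 2 * m 0 0 * tau ^+ 2 / 2)
 + (f (3 * tau) - f (2 * tau) - b * c 1 (2 * tau) * tau - b ^+ 2 * m 1 1 * tau ^+ 2 / 2)
 + (f (4 * tau) - f (3 * tau) - a * c 0 (3 * tau) * tau - a ^+ 2 * m 0 0 * tau ^+ 2 / 2))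
 + (b * tau * (c 1 tau - c 1 0 - - b * m 1 1 * tau)
 + b * tau * (c 1 (2 * tau) - c 1 tau - - a * m 1 0 * tau)
 + a * tau * (c 0 (2 * tau) - c 0 tau - - a * m 0 0 * tau)
 + a * tau * (c 0 (3 * tau) - c 0 (2 * tau) - b * m 0 1 * tau))|); last first.
  by congr (`|_|); field.
apply: le_trans (ler_normD _ _) _.
apply: le_trans (lerD (ler_norm4 _ _ _ _) (ler_norm4 _ _ _ _)) _.
apply: le_trans (lerD (lerD (lerD (lerD l1 l2) l3) l4)
  (lerD (lerD (lerD i1 i2) i3) i4)) _.
(* The bounds add up to [3 a^2 + 2 a b + 3 b^2] times [eta * tau ^+ 2], which falls short of the
   claim by [4 a b]. *)
rewrite -subr_ge0 [leRHS](_ : _ = 4 * a * b * (eta * tau ^+ 2)); last by ring.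
by rewrite !mulr_ge0// ltW.
Qed.

End Loop.

(** * Continuously differentiable functions *)

Section Smooth.
Variables (R : realType) (J : Type).
Implicit Types (f g : (J -> R) -> R) (df dg : (J -> R) -> (J -> R) -> R).
Implicit Types (q v : J -> R) (j : J).

(* Continuous differentiability, with [df q v] the derivative at [q] in the
   direction [v], in the form that is needed along curves and filters.  *)
Definition C1 f df : Prop :=
  [/\ forall (c : R -> J -> R) (t : R) v, (forall j, is_derive t 1 (c^~ j) (v j)) ->
        is_derive t 1 (fun t => f (c t)) (df (c t) v),
      forall (T : Type) (F : set_system T) (FF : Filter F) (c : T -> J -> R) q,
        (forall j, c x j @[x --> F] --> q j) -> f (c x) @[x --> F] --> f q
    & forall (T : Type) (F : set_system T) (FF : Filter F)
          (c w : T -> J -> R) q v,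
        (forall j, c x j @[x --> F] --> q j) ->
        (forall j, w x j @[x --> F] --> v j) ->
        df (c x) (w x) @[x --> F] --> df q v].

Definition smooth f : Prop := exists df, C1 f df.

Definition dird f q v : R := derive1 (fun t => f (fun j => q j + t * v j)) 0.

Lemma C1_dird f df q v : C1 f df -> dird f q v = df q v.
Proof.
move=> [df1 _ _]; rewrite /dird derive1E.
have /df1 h : forall j, is_derive (0 : R) 1 ((fun t j => q j + t * v j)^~ j) (v j).
  by move=> j; apply: is_derive_eq; rewrite /GRing.scale /=; ring.
rewrite (derive_val (is_derive := h)); congr (df _ _).
by apply/funext => j; rewrite mul0r addr0.
Qed.

(** The derivative along lines determines every witness [df], so [dird] is a canonical one and can
    be computed by rewriting. *)
Lemma smoothP f : smooth f -> C1 f (dird f).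
Proof.
move=> [df fdf]; suff -> : dird f = df by [].
by apply/funext => q; apply/funext => v; exact: C1_dird.
Qed.

Lemma C1_cst (r : R) : C1 (fun=> r) (fun _ _ => 0).
Proof. by split=> *; [exact: is_derive_cst|exact: cvg_cst|exact: cvg_cst]. Qed.

Lemma C1_coord j : C1 (fun q => q j) (fun _ v => v j).
Proof. by split=> *; eauto. Qed.

Lemma C1D f df g dg : C1 f df -> C1 g dg ->
  C1 (fun q => f q + g q) (fun q v => df q v + dg q v).
Proof.
move=> [f1 f2 f3] [g1 g2 g3]; split=> *; last 2 first.
- by apply: cvgD; eauto.
- by apply: cvgD; eauto.
- by apply: is_deriveD; eauto.
Qed.

Lemma C1N f df : C1 f df -> C1 (fun q => - f q) (fun q v => - df q v).
Proof.
move=> [f1 f2 f3]; split=> *; last 2 first.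
- by apply: cvgN; eauto.
- by apply: cvgN; eauto.
- by apply: is_deriveN; eauto.
Qed.

Lemma C1M f df g dg : C1 f df -> C1 g dg ->
  C1 (fun q => f q * g q) (fun q v => df q v * g q + f q * dg q v).
Proof.
move=> [f1 f2 f3] [g1 g2 g3]; split=> [c t v cv|*|*]; last 2 first.
- by apply: cvgM; eauto.
- by apply: cvgD; apply: cvgM; eauto.
- rewrite addrC [df _ _ * _]mulrC; apply: is_deriveM; eauto.
Qed.

Lemma C1V f df : (forall q, f q != 0) -> C1 f df ->
  C1 (fun q => (f q)^-1) (fun q v => - (f q ^- 2 * df q v)).
Proof.
move=> f0 [f1 f2 f3]; split=> [c t v cv|*|*]; last 2 first.
- by apply: cvgV; eauto.
- apply: cvgN; apply: cvgM; last by eauto.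
  by apply: cvgV; [rewrite expf_neq0|apply: cvgM; eauto].
- rewrite -mulNr; apply: is_deriveV; eauto.
Qed.

Lemma C1_sin f df : C1 f df ->
  C1 (fun q => sin (f q)) (fun q v => cos (f q) * df q v).
Proof.
move=> [f1 f2 f3]; split=> [c t v cv|*|*]; last 2 first.
- by apply: continuous_cvg; [exact: continuous_sin|eauto].
- apply: cvgM; last by eauto.
  by apply: continuous_cvg; [exact: continuous_cos|eauto].
- by apply: (@is_derive1_comp _ sin); eauto.
Qed.

Lemma C1_cos f df : C1 f df ->
  C1 (fun q => cos (f q)) (fun q v => - sin (f q) * df q v).
Proof.
move=> [f1 f2 f3]; split=> [c t v cv|*|*]; last 2 first.
- by apply: continuous_cvg; [exact: continuous_cos|eauto].
- apply: cvgM; last by eauto.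
  by apply: cvgN; apply: continuous_cvg; [exact: continuous_sin|eauto].
- by apply: (@is_derive1_comp _ cos); eauto.
Qed.

Lemma smooth_cst (r : R) : smooth (fun=> r).
Proof. by eexists; exact: C1_cst. Qed.
Lemma smooth_coord j : smooth (fun q => q j).
Proof. by eexists; exact: C1_coord. Qed.
Lemma smoothD f g : smooth f -> smooth g -> smooth (fun q => f q + g q).
Proof. by move=> [df fs] [dg gs]; eexists; exact: (C1D fs gs). Qed.
Lemma smoothN f : smooth f -> smooth (fun q => - f q).
Proof. by move=> [df fs]; eexists; exact: (C1N fs). Qed.
Lemma smoothM f g : smooth f -> smooth g -> smooth (fun q => f q * g q).
Proof. by move=> [df fs] [dg gs]; eexists; exact: (C1M fs gs). Qed.
Lemma smoothV f : (forall q, f q != 0) -> smooth f -> smooth (fun q => (f q)^-1).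
Proof. by move=> f0 [df fs]; eexists; exact: (C1V f0 fs). Qed.
Lemma smooth_sin f : smooth f -> smooth (fun q => sin (f q)).
Proof. by move=> [df fs]; eexists; exact: (C1_sin fs). Qed.
Lemma smooth_cos f : smooth f -> smooth (fun q => cos (f q)).
Proof. by move=> [df fs]; eexists; exact: (C1_cos fs). Qed.

Lemma dird_cst (r : R) q v : dird (fun=> r) q v = 0.
Proof. exact: (C1_dird _ _ (C1_cst r)). Qed.
Lemma dird_coord j q v : dird (fun q => q j) q v = v j.
Proof. exact: (C1_dird _ _ (C1_coord j)). Qed.
Lemma dirdD f g q v : smooth f -> smooth g ->
  dird (fun q => f q + g q) q v = dird f q v + dird g q v.
Proof. by move=> /smoothP fs /smoothP gs; exact: (C1_dird _ _ (C1D fs gs)). Qed.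
Lemma dirdN f q v : smooth f -> dird (fun q => - f q) q v = - dird f q v.
Proof. by move=> /smoothP fs; exact: (C1_dird _ _ (C1N fs)). Qed.
Lemma dirdM f g q v : smooth f -> smooth g ->
  dird (fun q => f q * g q) q v = dird f q v * g q + f q * dird g q v.
Proof. by move=> /smoothP fs /smoothP gs; exact: (C1_dird _ _ (C1M fs gs)). Qed.
Lemma dird_sin f q v : smooth f ->
  dird (fun q => sin (f q)) q v = cos (f q) * dird f q v.
Proof. by move=> /smoothP fs; exact: (C1_dird _ _ (C1_sin fs)). Qed.
Lemma dird_cos f q v : smooth f ->
  dird (fun q => cos (f q)) q v = - sin (f q) * dird f q v.
Proof. by move=> /smoothP fs; exact: (C1_dird _ _ (C1_cos fs)). Qed.

Lemma dird_eq0 f q v :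
  (forall t, f (fun j => q j + t * v j) = f q) -> dird f q v = 0.
Proof.
move=> fq; rewrite /dird (_ : (fun _ => _) = cst (f q)) ?derive1_cst//.
by apply/funext => t; rewrite fq.
Qed.

Lemma cvg_dird0 f q v : smooth f -> f q = 0 ->
  f (fun j => q j + eps * v j) / eps @[eps --> 0^'+] --> dird f q v.
Proof.
move=> /smoothP[f1 _ _] fq.
have /f1 h : forall j, is_derive (0 : R) 1 ((fun t j => q j + t * v j)^~ j) (v j).
  by move=> j; apply: is_derive_eq; rewrite /GRing.scale /=; ring.
have hd := ex_derive (is_derive := h).
have : 'D_1 (fun t : R => f (fun j => q j + t * v j)) 0 = dird f q v.
  rewrite (derive_val (is_derive := h)); congr (dird f _ _).
  by apply/funext => j; rewrite mul0r addr0.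
rewrite /derive => <-; apply: cvg_dnbhs_at_right.
move: hd; rewrite /derivable => /cvg_ex[l hl].
rewrite (cvg_lim _ hl)//; apply: cvg_trans hl; apply: near_eq_cvg; near=> e.
rewrite /= scaler1 /= addr0.
have -> : (fun j => q j + 0 * v j) = q by apply/funext => j; rewrite mul0r addr0.
by rewrite fq subr0 /GRing.scale /= mulrC.
Unshelve. all: by end_near.
Qed.

End Smooth.

(** * Balance of forces and torques *)

Lemma rev_ord2_0 : rev_ord (0 : 'I_2) = 1.
Proof. exact/val_inj. Qed.

Lemma rev_ord2_1 : rev_ord (1 : 'I_2) = 0.
Proof. exact/val_inj. Qed.

Lemma ord2P (P : 'I_2 -> Prop) : P 0 -> P 1 -> forall i, P i.
Proof.
by move=> P0 P1 [[|[|//]] h]; [move: P0|move: P1]; congr P; exact: val_inj.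
Qed.

(** * Plane vectors in a rotated orthonormal frame *)

Section Frame.
Variable R : realType.
Implicit Types (a b x y r : R) (u v w : 'cV[R]_2).

(** The vector with coordinates [x], [y] in the standard basis rotated by the angle [a]. *)
Definition frame a x y : 'cV[R]_2 :=
  vec2 (x * cos a - y * sin a) (x * sin a + y * cos a).

Lemma vec2D x y x' y' : vec2 x y + vec2 x' y' = vec2 (x + x') (y + y').
Proof. by apply/colP; apply: ord2P; rewrite !mxE. Qed.

Lemma vec2Z r x y : r *: vec2 x y = vec2 (r * x) (r * y).
Proof. by apply/colP; apply: ord2P; rewrite !mxE. Qed.

Lemma frameD a x y x' y' :
  frame a x y + frame a x' y' = frame a (x + x') (y + y').
Proof. by rewrite vec2D; congr vec2; ring. Qed.

Lemma frameZ r a x y : r *: frame a x y = frame a (r * x) (r * y).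
Proof. by rewrite vec2Z; congr vec2; ring. Qed.

Lemma frame0 a : frame a 0 0 = 0.
Proof. by apply/colP; apply: ord2P; rewrite !mxE /=; ring. Qed.

Lemma perp_frame a x y : perp (frame a x y) = frame a (- y) x.
Proof. by rewrite /perp !mxE /=; congr vec2; ring. Qed.

Lemma dotE u v : dot u v = u 0 0 * v 0 0 + u 1 0 * v 1 0.
Proof. by rewrite /dot big_ord_recl big_ord1; congr (_ + u _ _ * v _ _); exact: val_inj. Qed.

Lemma dotC u v : dot u v = dot v u.
Proof. by rewrite !dotE; ring. Qed.

Lemma dot_frame a b x y x' y' : dot (frame a x y) (frame b x' y')
  = cos (b - a) * (x * x' + y * y') + sin (b - a) * (y * x' - x * y').
Proof. by rewrite dotE !mxE /= cosB sinB; ring. Qed.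

Lemma dotDl u v w : dot (u + v) w = dot u w + dot v w.
Proof. by rewrite !dotE !mxE; ring. Qed.

Lemma dotZl r u v : dot (r *: u) v = r * dot u v.
Proof. by rewrite !dotE !mxE; ring. Qed.

Lemma trmx_mul_dot u v : u^T *m v = (dot u v)%:M.
Proof.
by apply/matrixP => i j; rewrite !ord1 !mxE mulr1n; apply: eq_bigr => k _; rewrite !mxE.
Qed.

End Frame.

Section Mechanics.
Variables (R : realType) (L Cpar Cperp lam : R).
Implicit Types (i j k : 'I_2) (q : 'I_2 + 'I_2 -> R) (dp dh : 'I_2 -> R).

(* The configuration is described by the directions [q (inl i)] of the
   symmetry axes and the half opening angles [q (inr i)]: the links of
   scallop [i] make the angles [q (inl i) - q (inr i)] and
   [q (inl i) + q (inr i)].  *)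
Definition base_angle q i : R := q (inl i) - q (inr i).
Definition open_angle q i : R := 2 * q (inr i).

Local Notation kap := (Cpar - Cperp).
Local Notation om := (omega L Cperp).

Definition axial_drag q i : R := Cperp + kap * (cos (q (inr i)) * cos (q (inr i))).
Definition side_drag q i : R := Cperp + kap * (sin (q (inr i)) * sin (q (inr i))).

(* A hinge free of force moves along the axis by [thrust] times the rate of
   the half opening, and across it by [drift] times the rotation rate.  *)
Definition thrust q i : R := L * Cperp / 2 * sin (q (inr i)) * (axial_drag q i)^-1.
Definition drift q i : R := - (L * Cperp / 2) * cos (q (inr i)) * (side_drag q i)^-1.

Definition tilt q i : R := sin (q (inl (rev_ord i)) - q (inl i)).

Definition inertia q i : R := om + L ^+ 2 * Cperp * cos (q (inr i)) * drift q i.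

Definition coupling q i : R := let n := rev_ord i in
  cos (q (inl n) - q (inl i)) *
  (om * cos (q (inr n) - q (inr i))
   + L ^+ 2 * kap * sin (q (inr n) - q (inr i)) * sin (q (inr n)) * drift q n
   + L ^+ 2 * Cperp * cos (q (inr i)) * drift q n).

Definition torque q i : R := let n := rev_ord i in
  - om * sin (q (inr n) - q (inr i))
  + L ^+ 2 * thrust q n * (kap * cos (q (inr n) - q (inr i)) * cos (q (inr n))
                           + Cperp * cos (q (inr i))).

Definition hinge_velocity q dp dh i : 'cV[R]_2 :=
  frame (q (inl i)) (thrust q i * dh i) (drift q i * dp i).

Definition body_velocity q dp dh : 'cV[R]_((2 + 1) + (2 + 1)) :=
  col_mx (col_mx (hinge_velocity q dp dh 0) (dp 0 - dh 0)%:M)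
         (col_mx (hinge_velocity q dp dh 1) (dp 1 - dh 1)%:M).

Definition net_torque q dp dh i : R := let n := rev_ord i in
  inertia q i * dp i - lam * (coupling q i * dp n + tilt q i * torque q i * dh n).

(** A convex combination of the two drag coefficients, with weights the squared sine and cosine. *)
Lemma axial_drag_gt0 q i : 0 < Cpar -> 0 < Cperp -> 0 < axial_drag q i.
Proof.
move=> C1 C2; rewrite /axial_drag.
have := cos2Dsin2 (q (inr i)); have := sqr_ge0 (sin (q (inr i))).
have := sqr_ge0 (cos (q (inr i))); rewrite -(expr2 (cos _)).
set c := cos _ ^+ 2; set s := sin _ ^+ 2 => c0 s0 cs.
have -> : Cperp + (Cpar - Cperp) * c = Cperp * (c + s) + (Cpar - Cperp) * c by rewrite cs mulr1.
have [s1|s1] := ltP 0 s; have := mulr_ge0 (ltW C1) c0; have := mulr_ge0 (ltW C2) s0; nra.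
Qed.

Lemma side_drag_gt0 q i : 0 < Cpar -> 0 < Cperp -> 0 < side_drag q i.
Proof.
move=> C1 C2; rewrite /side_drag.
have := cos2Dsin2 (q (inr i)); have := sqr_ge0 (sin (q (inr i))).
have := sqr_ge0 (cos (q (inr i))); rewrite -(expr2 (sin _)).
set c := cos _ ^+ 2; set s := sin _ ^+ 2 => c0 s0 cs.
have -> : Cperp + (Cpar - Cperp) * s = Cperp * (c + s) + (Cpar - Cperp) * s by rewrite cs mulr1.
have [s1|s1] := ltP 0 s; have := mulr_ge0 (ltW C1) c0; have := mulr_ge0 (ltW C2) s0; nra.
Qed.

Hypotheses (hL : 0 < L) (hCpar : 0 < Cpar) (hCperp : 0 < Cperp).

Lemma axial_drag_neq0 q i : axial_drag q i != 0.
Proof. by rewrite gt_eqF// axial_drag_gt0. Qed.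

Lemma side_drag_neq0 q i : side_drag q i != 0.
Proof. by rewrite gt_eqF// side_drag_gt0. Qed.

(** Up to a positive factor this is [4 * side_drag - 3 * Cperp * cos^2]. As [side_drag] equals
    [Cpar * sin^2 + Cperp * cos^2], the difference is at least [side_drag]. *)
Lemma inertia_gt0 q i : 0 < inertia q i.
Proof.
have D := side_drag_gt0 q i hCpar hCperp.
rewrite /inertia /drift /omega.
rewrite (_ : _ + _ = L ^+ 3 * Cperp / (6 * side_drag q i) *
  (4 * side_drag q i - 3 * Cperp * cos (q (inr i)) ^+ 2)); last first.
  by field; rewrite side_drag_neq0.
rewrite mulr_gt0//; first by rewrite divr_gt0 ?mulr_gt0 ?exprn_gt0.
suff : Cperp * cos (q (inr i)) ^+ 2 <= side_drag q i by move: D; lra.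
have -> : side_drag q i = Cpar * sin (q (inr i)) ^+ 2
    + Cperp * cos (q (inr i)) ^+ 2.
  by rewrite /side_drag cos2sin2; ring.
by rewrite lerDr mulr_ge0 ?sqr_ge0 1?ltW.
Qed.

Lemma link0E q i : link (base_angle q) (open_angle q) i 0
  = frame (q (inl i)) (cos (q (inr i))) (- sin (q (inr i))).
Proof.
rewrite /link /base_angle mul0r addr0 cosB sinB /frame; congr vec2; ring.
Qed.

Lemma link1E q i : link (base_angle q) (open_angle q) i 1
  = frame (q (inl i)) (cos (q (inr i))) (sin (q (inr i))).
Proof.
rewrite /link /base_angle /open_angle mul1r.
have -> : q (inl i) - q (inr i) + 2 * q (inr i) = q (inl i) + q (inr i) by ring.
by rewrite cosD sinD /frame; congr vec2; ring.
Qed.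

Lemma bcoefE q i : bcoef L Cperp (base_angle q) (open_angle q) i
  = frame (q (inl i)) 0 (L ^+ 2 * Cperp * cos (q (inr i))).
Proof.
by rewrite /bcoef link0E link1E frameD perp_frame frameZ; congr frame; field.
Qed.

Lemma alphacoefE q i : alphacoef L Cperp (base_angle q) (open_angle q) i
  = frame (q (inl i)) (- (L ^+ 2 / 2 * Cperp * sin (q (inr i))))
      (L ^+ 2 / 2 * Cperp * cos (q (inr i))).
Proof. by rewrite /alphacoef link1E perp_frame frameZ; congr frame; field. Qed.

(** The links are mirror images in the axis, so the mixed terms of the two projections cancel and
    axis and normal are eigenvectors of the drag matrix. *)
Lemma Acoef_frame q i x y :
  Acoef L Cpar Cperp (base_angle q) (open_angle q) i *m frame (q (inl i)) x y
  = frame (q (inl i)) (2 * L * axial_drag q i * x) (2 * L * side_drag q i * y).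
Proof.
rewrite /Acoef -scalemxAl mulmxDl mul_scalar_mx -scalemxAl mulmxDl /link_proj.
rewrite -!mulmxA !trmx_mul_dot !mul_mx_scalar link0E link1E !dot_frame subrr cos0 sin0.
by rewrite !(frameZ, frameD) /axial_drag /side_drag; congr frame; field.
Qed.

(** The base angle turns at the rate [dp i - dh i] and the opening grows at [2 * dh i]. In the frame
    of the axis the equation is diagonal, and [thrust] and [drift] are its solutions. *)
Lemma force_balance q dp dh i :
  let A := Acoef L Cpar Cperp (base_angle q) (open_angle q) i in
  let b := bcoef L Cperp (base_angle q) (open_angle q) i in
  let alpha := alphacoef L Cperp (base_angle q) (open_angle q) i in
  A *m hinge_velocity q dp dh i + (dp i - dh i) *: b + (2 * dh i) *: alpha = 0.
Proof.
rewrite /= /hinge_velocity Acoef_frame bcoefE alphacoefE !(frameZ, frameD).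
rewrite -[RHS](frame0 (q (inl i))) /thrust /drift.
by congr frame; field; rewrite ?axial_drag_neq0 ?side_drag_neq0.
Qed.

(** The opening rate drops out: [bcoef] is normal to the axis, hence orthogonal to the thrust, and
    the two [omega] terms in [dh i] cancel. *)
Lemma self_torque q dp dh i :
  let b := bcoef L Cperp (base_angle q) (open_angle q) i in
  dot b (hinge_velocity q dp dh i) + om * (dp i - dh i) + 2 * dh i * (om / 2)
  = inertia q i * dp i.
Proof.
by rewrite /= bcoefE dot_frame subrr cos0 sin0 /inertia; field.
Qed.

(** For parallel axes, reflection in the axis exchanges the links of each scallop and reverses
    torques, so opening the other scallop exerts none. This is why the terms in [dh n] share the
    factor [tilt]. *)
Lemma mutual_torque q dp dh i : let n := rev_ord i in
  let ln := link (base_angle q) (open_angle q) in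
  let d := dcoef L Cpar Cperp (base_angle q) (open_angle q) i in
  dot d (hinge_velocity q dp dh n)
  + L ^+ 3 * Cperp / 3 * (dot (ln i 0) (ln n 0) + dot (ln i 1) (ln n 1)) * (dp n - dh n)
  + 2 * dh n * (L ^+ 3 * Cperp / 3 * dot (ln i 1) (ln n 1))
  = coupling q i * dp n + tilt q i * torque q i * dh n.
Proof.
rewrite /= /dcoef bcoefE !link0E !link1E !perp_frame /hinge_velocity.
rewrite !(dotDl, dotZl) !dot_frame subrr cos0 sin0 /coupling /tilt /torque.
rewrite !(cosB (q (inr _))) !(sinB (q (inr _))) /omega.
by field.
Qed.

(** Each force row is the force on one scallop minus [lam] times that on the other. Both vanish by
    [force_balance], and only the torque rows remain. *)
Lemma balance q dp dh :
  let Rm := resistance L Cpar Cperp lam (base_angle q) (open_angle q) in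
  let phi := shape_force L Cperp lam (base_angle q) (open_angle q) in
  Rm *m body_velocity q dp dh
    + ((2 * dh 0) *: phi 0 + (2 * dh 1) *: phi 1)
  = col_mx (col_mx 0 (net_torque q dp dh 0)%:M)
           (col_mx 0 (net_torque q dp dh 1)%:M).
Proof.
have F := force_balance q dp dh; have T := self_torque q dp dh.
have M0 := mutual_torque q dp dh 0; have M1 := mutual_torque q dp dh 1.
rewrite /= rev_ord2_0 in M0; rewrite /= rev_ord2_1 in M1.
have {F} [F0 F1] := (F 0, F 1); have {T} [T0 T1] := (T 0, T 1); move: F0 F1 T0 T1 M0 M1.
rewrite /resistance /body_velocity /shape_force /net_torque /= rev_ord2_0 rev_ord2_1.
rewrite /betacoef /varpi.
set th := base_angle q; set sg := open_angle q.
move: (hinge_velocity q dp dh) => x.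
set A0 := Acoef _ _ _ _ _ 0; set A1 := Acoef _ _ _ _ _ 1.
set b0 := bcoef _ _ _ _ 0; set b1 := bcoef _ _ _ _ 1.
set a0 := alphacoef _ _ _ _ 0; set a1 := alphacoef _ _ _ _ 1.
set d0 := dcoef _ _ _ _ _ 0; set d1 := dcoef _ _ _ _ _ 1.
rewrite (dotC (link th sg 1 0)) (dotC (link th sg 1 1)).
set V := dot _ _ + dot _ _; set B := dot (link th sg 0 1) _.
clearbody A0 A1 b0 b1 a0 a1 d0 d1 V B => F0 F1 T0 T1 M0 M1.
have force0 : A0 *m x 0 = - ((dp 0 - dh 0) *: b0 + (2 * dh 0) *: a0).
  by apply/eqP; rewrite -addr_eq0 addrA F0.
have force1 : A1 *m x 1 = - ((dp 1 - dh 1) *: b1 + (2 * dh 1) *: a1).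
  by apply/eqP; rewrite -addr_eq0 addrA F1.
rewrite !(mul_block_col, scale_col_mx, add_col_mx).
rewrite -!scalemxAl !mul_mx_scalar force0 force1 !trmx_mul_dot.
rewrite !scale_scalar_mx -!raddfD /= -T0 -T1 -M0 -M1.
congr col_mx; congr col_mx; try by congr (_%:M); ring.
- by apply/colP => k; rewrite !mxE; ring.
- by apply/colP => k; rewrite !mxE; ring.
Qed.

Definition torque_det q : R :=
  inertia q 0 * inertia q 1 - lam ^+ 2 * coupling q 0 * coupling q 1.

(** Cramer's rule for the torque equations, with [tilt q i] factored out. The minus sign on the
    diagonal appears because [tilt] changes sign when the scallops are exchanged. *)
Definition turn q i j : R := let n := rev_ord i in
  if i == j then - (lam ^+ 2 * coupling q i * torque q n * (torque_det q)^-1)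
  else lam * inertia q n * torque q i * (torque_det q)^-1.

Definition rotation q dh i : R := tilt q i * (turn q i 0 * dh 0 + turn q i 1 * dh 1).

Hypothesis hinv : forall theta sigma : 'I_2 -> R,
  resistance L Cpar Cperp lam theta sigma \in unitmx.

(* Otherwise the rotation rates [lam * coupling q 0] and [inertia q 0] are
   free of force and torque.  *)
Lemma torque_det_neq0 q : torque_det q != 0.
Proof.
apply/eqP => d0; pose dp i := if i == 0 then lam * coupling q 0 else inertia q 0.
have := balance q dp (fun=> 0).
rewrite /= /net_torque /dp /= !mulr0 !scale0r !addr0.
rewrite (_ : (inertia q 0 * _ - _) = 0); last by ring.
rewrite (_ : (inertia q 1 * _ - _) = 0); last by rewrite -d0 /torque_det; ring.
rewrite raddf0 !col_mx0 => /(congr1 (mulmx (invmx (resistance L Cpar Cperp lam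
  (base_angle q) (open_angle q))))).
rewrite mulKmx// mulmx0 /body_velocity => /(congr1 (fun v => dsubmx (dsubmx v) 0 0)).
rewrite !(col_mxKd, linear0) !mxE /= mulr1n addr0 => /eqP.
by rewrite gt_eqF// inertia_gt0.
Qed.

Lemma net_torque_rotation q dh i : net_torque q (rotation q dh) dh i = 0.
Proof.
move: i; apply: ord2P; rewrite /net_torque /rotation /turn /tilt /= !(rev_ord2_0, rev_ord2_1).
all: have := torque_det_neq0 q.
all: rewrite -(opprB (q (inl 1)) (q (inl 0))) sinN /torque_det => d0; field; exact: d0.
Qed.

(** By [balance], the explicit body velocity is mapped by the resistance matrix to minus the shape
    force, and the matrix can be cancelled. *)
Lemma control_fieldE q (u : 'I_2 -> R) (dh := fun i => u i / 2) :
  let v := control_field L Cpar Cperp lam (base_angle q) (open_angle q) in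
  u 0 *: v 0 + u 1 *: v 1
  = col_mx (body_velocity q (rotation q dh) dh) (\col_i u i).
Proof.
rewrite /= /control_field !scale_col_mx add_col_mx; congr col_mx; last first.
  by apply/colP; apply: ord2P; rewrite !mxE /=; ring.
have := balance q (rotation q dh) dh.
rewrite /= !net_torque_rotation raddf0 !col_mx0 /dh => /eqP.
rewrite addr_eq0 => /eqP/(congr1 (mulmx (invmx (resistance L Cpar Cperp lam
  (base_angle q) (open_angle q))))).
rewrite mulKmx// => ->.
rewrite mulmxN mulmxDr -!scalemxAr !scalerN opprD.
by congr (- (_ *: _) - (_ *: _)); field.
Qed.

End Mechanics.

(** * Coefficients of the control fields *)

Create HintDb smooth.

Ltac smoothness :=
  repeat first [ assumption | exact: smooth_cst | exact: smooth_coord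
    | solve [eauto with nocore smooth]
    | apply: smooth_sin | apply: smooth_cos | apply: smoothN
    | apply: smoothD | apply: smoothM ].


Section Coefficients.
Variables (R : realType) (L Cpar Cperp lam : R).
Implicit Types (i j k : 'I_2) (q v : 'I_2 + 'I_2 -> R).

Hypotheses (hL : 0 < L) (hCpar : 0 < Cpar) (hCperp : 0 < Cperp).
Hypothesis hinv : forall theta sigma : 'I_2 -> R,
  resistance L Cpar Cperp lam theta sigma \in unitmx.

Local Notation thrust := (thrust L Cpar Cperp).
Local Notation drift := (drift L Cpar Cperp).
Local Notation inertia := (inertia L Cpar Cperp).
Local Notation coupling := (coupling L Cpar Cperp).
Local Notation torque := (torque L Cpar Cperp).
Local Notation torque_det := (torque_det L Cpar Cperp lam).
Local Notation turn := (turn L Cpar Cperp lam).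

Lemma smooth_thrust i : smooth (fun q => thrust q i).
Proof.
apply: smoothM; first by smoothness.
by apply: smoothV => [q|]; [exact: axial_drag_neq0|rewrite /axial_drag; smoothness].
Qed.

Lemma smooth_drift i : smooth (fun q => drift q i).
Proof.
apply: smoothM; first by smoothness.
by apply: smoothV => [q|]; [exact: side_drag_neq0|rewrite /side_drag; smoothness].
Qed.
Local Hint Resolve smooth_thrust smooth_drift : smooth.

Lemma smooth_tilt i : smooth (fun q : 'I_2 + 'I_2 -> R => tilt q i).
Proof. by rewrite /tilt; smoothness. Qed.

Lemma smooth_inertia i : smooth (fun q => inertia q i).
Proof. by rewrite /inertia; smoothness. Qed.

Lemma smooth_coupling i : smooth (fun q => coupling q i).
Proof. by rewrite /coupling; smoothness. Qed.

Lemma smooth_torque i : smooth (fun q => torque q i).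
Proof. by rewrite /torque; smoothness. Qed.
Local Hint Resolve smooth_tilt smooth_inertia smooth_coupling smooth_torque : smooth.

Lemma smooth_torque_detV : smooth (fun q => (torque_det q)^-1).
Proof.
by apply: smoothV => [q|]; [exact: torque_det_neq0|rewrite /torque_det; smoothness].
Qed.
Local Hint Resolve smooth_torque_detV : smooth.

Lemma smooth_turn i j : smooth (fun q => turn q i j).
Proof. by rewrite /turn; case: eqP => _; smoothness. Qed.
Local Hint Resolve smooth_turn : smooth.

(** The control fields on configurations, per unit rate of the half opening; the loop therefore has
    the amplitudes [gamma1 / 2] and [gamma2 / 2]. *)
Definition shape_field k q (x : 'I_2 + 'I_2) : R :=
  match x with inl i => tilt q i * turn q i k | inr i => (i == k)%:R end.

(* Component in the direction [zeta] of the velocity of hinge [i] in the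
   motion [shape_field j].  *)
Definition slip (zeta : R) i j q : R :=
  (i == j)%:R * thrust q i * cos (q (inl i) - zeta)
  - drift q i * sin (q (inl i) - zeta) * tilt q i * turn q i j.

Lemma smooth_slip zeta i j : smooth (slip zeta i j).
Proof. by rewrite /slip; smoothness. Qed.

Lemma smooth_shape_field k x : smooth (fun q => shape_field k q x).
Proof. by case: x => i /=; smoothness. Qed.

Lemma dird_tilt i q v (n := rev_ord i) : dird (fun q => tilt q i) q v
  = cos (q (inl n) - q (inl i)) * (v (inl n) - v (inl i)).
Proof.
rewrite /tilt dird_sin; last by smoothness.
rewrite dirdD; try by smoothness.
by rewrite dirdN ?dird_coord//; smoothness.
Qed.

Lemma dird_slip zeta i j q v : dird (slip zeta i j) q v
  = (i == j)%:R * (dird (fun q => thrust q i) q v * cos (q (inl i) - zeta)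
                   - thrust q i * sin (q (inl i) - zeta) * v (inl i))
  - (dird (fun q => drift q i) q v * sin (q (inl i) - zeta) * tilt q i * turn q i j
     + drift q i * cos (q (inl i) - zeta) * v (inl i) * tilt q i * turn q i j
     + drift q i * sin (q (inl i) - zeta) * dird (fun q => tilt q i) q v * turn q i j
     + drift q i * sin (q (inl i) - zeta) * tilt q i * dird (fun q => turn q i j) q v).
Proof.
(* The coefficients are replaced by arbitrary smooth functions, so that the differentiation rules
   stop at them. *)
have key (r : R) (T D S G : ('I_2 + 'I_2 -> R) -> R) :
    smooth T -> smooth D -> smooth S -> smooth G ->
    dird (fun q => r * T q * cos (q (inl i) - zeta)
                   - D q * sin (q (inl i) - zeta) * S q * G q) q v
    = r * (dird T q v * cos (q (inl i) - zeta)
           - T q * sin (q (inl i) - zeta) * v (inl i))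
      - (dird D q v * sin (q (inl i) - zeta) * S q * G q
         + D q * cos (q (inl i) - zeta) * v (inl i) * S q * G q
         + D q * sin (q (inl i) - zeta) * dird S q v * G q
         + D q * sin (q (inl i) - zeta) * S q * dird G q v).
  move=> sT sD sS sG.
  have angle : dird (fun q => q (inl i) - zeta) q v = v (inl i).
    by rewrite dirdD ?dird_coord ?dird_cst ?addr0//; smoothness.
  rewrite dirdD; try by smoothness.
  rewrite dirdN; last by smoothness.
  rewrite !dirdM; try by smoothness.
  rewrite dird_sin; last by smoothness.
  rewrite dird_cos; last by smoothness.
  by rewrite dird_cst angle; ring.
exact: (key _ _ _ _ _ (smooth_thrust i) (smooth_drift i) (smooth_tilt i) (smooth_turn i j)).
Qed.

End Coefficients.

(** * Small amplitudes *)

Section SmallAmplitude.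
Variables (R : realType) (L Cpar Cperp lam theta0 zeta : R).
Implicit Types (i j k : 'I_2) (q v : 'I_2 + 'I_2 -> R) (y : 'I_2 -> R).

Hypotheses (hL : 0 < L) (hCpar : 0 < Cpar) (hCperp : 0 < Cperp).
Hypothesis hinv : forall theta sigma : 'I_2 -> R,
  resistance L Cpar Cperp lam theta sigma \in unitmx.

Local Notation thrust := (thrust L Cpar Cperp).
Local Notation drift := (drift L Cpar Cperp).
Local Notation inertia := (inertia L Cpar Cperp).
Local Notation coupling := (coupling L Cpar Cperp).
Local Notation torque := (torque L Cpar Cperp).
Local Notation torque_det := (torque_det L Cpar Cperp lam).
Local Notation turn := (turn L Cpar Cperp lam).
Local Notation shape_field := (shape_field L Cpar Cperp lam).
Local Notation slip := (slip L Cpar Cperp lam zeta).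
Local Notation om := (omega L Cperp).

Definition straight (x : 'I_2 + 'I_2) : R :=
  match x with inl _ => theta0 + pi / 2 | inr _ => pi / 2 end.

(* Opening scallop [i] by [2 * y i] at fixed base angle turns its axis by [y i].  *)
Definition spread y (x : 'I_2 + 'I_2) : R :=
  match x with inl i => y i | inr i => y i end.

Definition bent y (eps : R) (x : 'I_2 + 'I_2) : R :=
  straight x + eps * spread y x.

Definition axis_rate k (x : 'I_2 + 'I_2) : R :=
  match x with inl _ => 0 | inr i => (i == k)%:R end.

Lemma tilt_straight i : tilt straight i = 0.
Proof. by rewrite /tilt /= subrr sin0. Qed.

Lemma drift_straight i : drift straight i = 0.
Proof. by rewrite /drift /= cos_pihalf mulr0 mul0r. Qed.

Lemma torque_straight i : torque straight i = 0.
Proof. by rewrite /torque /= subrr sin0 cos_pihalf !mulr0 addr0 mulr0 addr0. Qed.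

Lemma turn_straight i j : turn straight i j = 0.
Proof. by rewrite /turn; case: ifP; rewrite torque_straight ?mulr0 ?mul0r ?oppr0. Qed.

Lemma shape_field_straight k : shape_field k straight = axis_rate k.
Proof. by apply/funext => -[i|i] //=; rewrite tilt_straight mul0r. Qed.

Lemma cvg_eps : eps @[eps --> (0 : R)^'+] --> (0 : R).
Proof. by apply: cvg_at_right_filter; exact: cvg_id. Qed.

Lemma bent_cvg y x : bent y eps x @[eps --> 0^'+] --> straight x.
Proof.
rewrite -[X in _ --> X]addr0 -[X in _ + X](mul0r (spread y x)).
apply: cvgD; first exact: cvg_cst.
by apply: cvgM; [exact: cvg_eps|exact: cvg_cst].
Qed.

Lemma smooth_bent f y : smooth f -> f (bent y eps) @[eps --> 0^'+] --> f straight.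
Proof.
by move=> /smoothP[_ fc _]; apply: fc => x; exact: bent_cvg.
Qed.

Lemma dird_bent f y k : smooth f ->
  dird f (bent y eps) (shape_field k (bent y eps)) @[eps --> 0^'+]
  --> dird f straight (axis_rate k).
Proof.
move=> /smoothP[_ _ fc]; apply: fc => x; first exact: bent_cvg.
rewrite -shape_field_straight.
by have := @smooth_bent _ y (smooth_shape_field hL hCpar hCperp hinv k x).
Qed.

Lemma dird_thrust0 i q v : v (inr i) = 0 -> dird (fun q => thrust q i) q v = 0.
Proof.
by move=> v0; apply: dird_eq0 => t; rewrite /thrust /axial_drag v0 mulr0 addr0.
Qed.

(** The terms of [dird_slip] divided by [e^2]: [S], [D], [Gj], [Gk], [Sn], [Gn] stand for [tilt],
    [drift] and [turn] divided by [e], the last two at the other scallop. The surplus powers of [e]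
    mark the terms that vanish in the limit. *)
Lemma expansion_limit (b : R) (P sn cs cd dD dG S D Gj Gk Sn Gn : R -> R)
    (p s c dd dg sl d gj gk sn' gn : R) :
  P e @[e --> 0^'+] --> p -> sn e @[e --> 0^'+] --> s ->
  cs e @[e --> 0^'+] --> c -> cd e @[e --> 0^'+] --> (1 : R) ->
  dD e @[e --> 0^'+] --> dd -> dG e @[e --> 0^'+] --> dg ->
  S e @[e --> 0^'+] --> sl -> D e @[e --> 0^'+] --> d ->
  Gj e @[e --> 0^'+] --> gj -> Gk e @[e --> 0^'+] --> gk ->
  Sn e @[e --> 0^'+] --> sn' -> Gn e @[e --> 0^'+] --> gn ->
  - (b * P e * sn e * S e * Gk e)
  - (dD e * sn e * S e * Gj e
     + D e * cs e * (e * e * e) * S e * Gk e * S e * Gj e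
     + D e * sn e * (cd e * (e * e) * (Sn e * Gn e - S e * Gk e)) * Gj e
     + D e * sn e * S e * dG e) @[e --> 0^'+] -->
  - (b * p * s * sl * gk) - (dd * s * sl * gj + d * s * sl * dg).
Proof.
move=> hP hsn hcs hcd hdD hdG hS hD hGj hGk hSn hGn.
have -> : - (b * p * s * sl * gk) - (dd * s * sl * gj + d * s * sl * dg)
  = - (b * p * s * sl * gk)
  - (dd * s * sl * gj + d * c * (0 * 0 * 0) * sl * gk * sl * gj
     + d * s * (1 * (0 * 0) * (sn' * gn - sl * gk)) * gj
     + d * s * sl * dg) by ring.
have e0 := cvg_eps.
have M (f g : R -> R) (u v : R) : f e @[e --> 0^'+] --> u ->
    g e @[e --> 0^'+] --> v -> f e * g e @[e --> 0^'+] --> u * v by exact: cvgM.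
have A (f g : R -> R) (u v : R) : f e @[e --> 0^'+] --> u ->
    g e @[e --> 0^'+] --> v -> f e + g e @[e --> 0^'+] --> u + v by exact: cvgD.
have N (f : R -> R) (u : R) : f e @[e --> 0^'+] --> u ->
    - f e @[e --> 0^'+] --> - u by exact: cvgN.
have cc (r : R) : (fun=> r) e @[e --> (0 : R)^'+] --> r by exact: cvg_cst.
apply: (@A).
  exact: (N _ _ (M _ _ _ _ (M _ _ _ _ (M _ _ _ _ (M _ _ _ _ (cc b) hP) hsn) hS) hGk)).
apply: (@N); apply: (@A); last exact: (M _ _ _ _ (M _ _ _ _ (M _ _ _ _ hD hsn) hS) hdG).
apply: (@A).
  apply: (@A); first exact: (M _ _ _ _ (M _ _ _ _ (M _ _ _ _ hdD hsn) hS) hGj).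
  apply: (@M _ _ _ _ _ hGj); apply: (@M _ _ _ _ _ hS).
  apply: (@M _ _ _ _ _ hGk); apply: (@M _ _ _ _ _ hS); apply: (@M _ _ _ _ (M _ _ _ _ hD hcs)).
  exact: (M _ _ _ _ (M _ _ _ _ e0 e0) e0).
apply: (@M _ _ _ _ _ hGj); apply: (@M _ _ _ _ (M _ _ _ _ hD hsn)); apply: (@M).
  exact: (M _ _ _ _ hcd (M _ _ _ _ e0 e0)).
exact: (A _ _ _ _ (M _ _ _ _ hSn hGn) (N _ _ (M _ _ _ _ hS hGk))).
Qed.

(** The axes turn only at the rate [tilt * turn], of order [eps^2]. Hence differentiating [tilt], or
    the sine multiplying [drift], gives higher order; what survives is the turning of the thrust and
    the derivatives of [drift] and [turn]. *)
Lemma slip_second_order y i j k : k != j ->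
  dird (slip i j) (bent y eps) (shape_field k (bent y eps)) / eps ^+ 2
    @[eps --> 0^'+] -->
  let s := sin (theta0 + pi / 2 - zeta) in
  let dS := dird (fun q => tilt q i) straight (spread y) in
  let dr := dird (fun q => drift q i) straight in
  let dG j := dird (fun q => turn q i j) straight in
  - ((i == j)%:R * thrust straight i * s * dS * dG k (spread y))
  - (dr (axis_rate k) * s * dS * dG j (spread y)
     + dr (spread y) * s * dS * dG j (axis_rate k)).
Proof.
move=> kj /=.
pose s := sin (theta0 + pi / 2 - zeta).
pose dS := dird (fun q => tilt q i) straight (spread y).
pose dr := dird (fun q => drift q i) straight.
pose dG l := dird (fun q => turn q i l) straight.
have St := smooth_thrust L hCpar hCperp i; have Sd := smooth_drift L hCpar hCperp i.
have Ss := @smooth_tilt R i; have Sg := smooth_turn hL hCpar hCperp hinv i.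
have hS := @cvg_dird0 _ _ _ _ (spread y) Ss (tilt_straight i).
have hr := @cvg_dird0 _ _ _ _ (spread y) Sd (drift_straight i).
have hG l := @cvg_dird0 _ _ _ _ (spread y) (Sg l) (turn_straight i l).
have hSn := @cvg_dird0 _ _ _ _ (spread y) (@smooth_tilt R (rev_ord i))
  (tilt_straight (rev_ord i)).
have hGn := @cvg_dird0 _ _ _ _ (spread y) (smooth_turn hL hCpar hCperp hinv (rev_ord i) k)
  (turn_straight _ _).
have hP := @smooth_bent _ y St.
have hsin : sin (bent y eps (inl i) - zeta) @[eps --> 0^'+] --> s.
  have sm : smooth (fun q => sin (q (inl i) - zeta)) by smoothness.
  exact: (@smooth_bent _ y sm).
have hcos : cos (bent y eps (inl i) - zeta) @[eps --> 0^'+] --> cos (theta0 + pi / 2 - zeta).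
  have sm : smooth (fun q => cos (q (inl i) - zeta)) by smoothness.
  exact: (@smooth_bent _ y sm).
have hcd : cos (bent y eps (inl (rev_ord i)) - bent y eps (inl i)) @[eps --> 0^'+] --> (1 : R).
  have sm : smooth (fun q => cos (q (inl (rev_ord i)) - q (inl i))) by smoothness.
  by have := @smooth_bent _ y sm; rewrite /= subrr cos0.
have hdr := @dird_bent _ y k Sd.
have hdG := @dird_bent _ y k (Sg j).
have := expansion_limit (b := (i == j)%:R) hP hsin hcos hcd hdr hdG hS hr (hG j) (hG k) hSn hGn.
apply: cvg_trans; apply: near_eq_cvg; near=> eps.
have eps0 : eps != 0 by rewrite gt_eqF//; near: eps; exact: nbhs_right_gt.
rewrite (dird_slip hL hCpar hCperp hinv) dird_tilt.
(* Field [k] changes only the half opening of scallop [k], and [thrust] of scallop [j] depends only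
   on that of [j]. *)
have -> : (i == j)%:R * (dird (fun q => thrust q i) (bent y eps)
    (shape_field k (bent y eps)) * cos (bent y eps (inl i) - zeta)
    - thrust (bent y eps) i * sin (bent y eps (inl i) - zeta)
      * shape_field k (bent y eps) (inl i))
  = - ((i == j)%:R * thrust (bent y eps) i * sin (bent y eps (inl i) - zeta)
      * shape_field k (bent y eps) (inl i)).
  case: eqP => [ij|]; last by rewrite !mul0r oppr0.
  by rewrite dird_thrust0 ?mul0r ?mul1r ?sub0r//= ij eq_sym (negPf kj).
rewrite /=.
rewrite -!/(bent y eps).
by field.
Unshelve. all: by end_near.
Qed.

Lemma thrust_straight i : thrust straight i = L / 2.
Proof.
rewrite /thrust /axial_drag /= cos_pihalf sin_pihalf !mulr0 addr0.
by field; rewrite gt_eqF.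
Qed.

Lemma inertia_straight i : inertia straight i = om.
Proof. by rewrite /inertia drift_straight mulr0 addr0. Qed.

Lemma coupling_straight i : coupling straight i = om.
Proof.
by rewrite /coupling !drift_straight /= !subrr cos0 !mulr0 !addr0 mulr1 mul1r.
Qed.

Lemma dird_drift_straight i v :
  dird (fun q => drift q i) straight v = L * Cperp / (2 * Cpar) * v (inr i).
Proof.
have key (f g : ('I_2 + 'I_2 -> R) -> R) : smooth f -> smooth g ->
    f straight = 0 -> dird (fun q => f q * g q) straight v
    = dird f straight v * g straight.
  by move=> sf sg f0; rewrite dirdM// f0 mul0r addr0.
rewrite /drift key; last 3 first.
- by smoothness.
- apply: smoothV => [q|]; [exact: side_drag_neq0|rewrite /side_drag; smoothness].
- by rewrite /= cos_pihalf mulr0.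
rewrite dirdM; try by smoothness.
rewrite dird_cst dird_cos; last by smoothness.
rewrite dird_coord /side_drag /= sin_pihalf (_ : Cperp + _ = Cpar); last by ring.
by field; rewrite gt_eqF.
Qed.

Lemma dird_torque_straight i v (n := rev_ord i) :
  dird (fun q => torque q i) straight v
  = (om - L ^+ 3 / 2 * Cperp) * v (inr i)
    + (- om - L ^+ 3 / 2 * (Cpar - Cperp)) * v (inr n).
Proof.
have key (T : ('I_2 + 'I_2 -> R) -> R) : smooth T -> T straight = L / 2 ->
    dird (fun q => - om * sin (q (inr n) - q (inr i))
     + L ^+ 2 * T q * ((Cpar - Cperp) * cos (q (inr n) - q (inr i)) * cos (q (inr n))
                       + Cperp * cos (q (inr i)))) straight v
    = (om - L ^+ 3 / 2 * Cperp) * v (inr i)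
      + (- om - L ^+ 3 / 2 * (Cpar - Cperp)) * v (inr n).
  move=> sT T0.
  have angle : dird (fun q => q (inr n) - q (inr i)) straight v = v (inr n) - v (inr i).
    by rewrite dirdD ?dirdN ?dird_coord//; smoothness.
  rewrite dirdD; try by smoothness.
  rewrite !dirdM; try by smoothness.
  rewrite dirdD; try by smoothness.
  rewrite !dirdM; try by smoothness.
  rewrite !dird_cst dird_sin; last by smoothness.
  rewrite !dird_cos; try by smoothness.
  rewrite angle !dird_coord T0 /= subrr cos0 sin0 cos_pihalf sin_pihalf.
  by field.
exact: (key _ (smooth_thrust L hCpar hCperp n) (thrust_straight n)).
Qed.

(** Every entry has a factor [torque], which vanishes at the straight configuration, so only that
    factor is differentiated. *)
Lemma dird_turn_straight i j v (n := rev_ord i) :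
  dird (fun q => turn q i j) straight v
  = (torque_det straight)^-1 * om *
    (if i == j then - (lam ^+ 2 * dird (fun q => torque q n) straight v)
     else lam * dird (fun q => torque q i) straight v).
Proof.
have key (r : R) (f g d : ('I_2 + 'I_2 -> R) -> R) : smooth f -> smooth g ->
    smooth d -> g straight = 0 -> dird (fun q => r * f q * g q * d q) straight v
    = r * f straight * dird g straight v * d straight.
  move=> sf sg sd g0; rewrite dirdM; try by smoothness.
  rewrite dirdM; try by smoothness.
  by rewrite g0; ring.
have sV := smooth_torque_detV hL hCpar hCperp hinv.
have sT k := smooth_torque L hCpar hCperp k.
have sC k := smooth_coupling L hCpar hCperp k.
have sI k := smooth_inertia L hCpar hCperp k.
rewrite /turn; case: eqP => _.
  rewrite dirdN; last first.
    by apply: smoothM => //; apply: smoothM => //; apply: smoothM => //; smoothness.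
  by rewrite (key _ _ _ _ (sC i) (sT n) sV (torque_straight n)) coupling_straight; ring.
by rewrite (key _ _ _ _ (sI n) (sT i) sV (torque_straight i)) inertia_straight; ring.
Qed.

Definition midpoint_rate j q : R := 2^-1 * (slip 0 j q + slip 1 j q).

Lemma smooth_midpoint_rate j : smooth (midpoint_rate j).
Proof.
have s0 := smooth_slip hL hCpar hCperp hinv zeta 0 j.
have s1 := smooth_slip hL hCpar hCperp hinv zeta 1 j.
by apply: smoothM; [smoothness|apply: smoothD].
Qed.

(* The midpoint component of the commutator of the two control fields.  *)
Definition midpoint_curl q : R :=
  dird (midpoint_rate 0) q (shape_field 1 q)
  - dird (midpoint_rate 1) q (shape_field 0 q).

(** The derivative of [tilt] gives the factor [y 1 - y 0], and the remaining linear factors combine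
    to a multiple of [y 0 + y 1]. The sine in the witness is [cos (theta0 - zeta)]: to this order
    the midpoint moves along the straightened links. *)
Lemma midpoint_curl_second_order : exists C : R, forall y,
  midpoint_curl (bent y eps) / eps ^+ 2 @[eps --> 0^'+]
  --> C * (y 1 ^+ 2 - y 0 ^+ 2).
Proof.
have mr j q v : dird (midpoint_rate j) q v
    = 2^-1 * (dird (slip 0 j) q v + dird (slip 1 j) q v).
  have s0 := smooth_slip hL hCpar hCperp hinv zeta 0 j.
  have s1 := smooth_slip hL hCpar hCperp hinv zeta 1 j.
  rewrite /midpoint_rate dirdM; [|exact: smooth_cst|exact: smoothD].
  by rewrite dird_cst mul0r add0r dirdD.
(* [A] and [B] are the slopes of [torque] in the own and the other half opening, [K] is the common
   factor of the slopes of [turn], and [rho] is the slope of [drift]. *)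
pose A := om - L ^+ 3 / 2 * Cperp.
pose B := - om - L ^+ 3 / 2 * (Cpar - Cperp).
pose K := (torque_det straight)^-1 * om.
pose rho := L * Cperp / (2 * Cpar).
exists (sin (theta0 + pi / 2 - zeta) / 2 *
  ((rho - L / 2) * (K * lam) * (A + B) + rho * A * (K * lam + K * lam ^+ 2))) => y.
have e01 : (1 : 'I_2) != 0 by []. have e10 : (0 : 'I_2) != 1 by [].
have h00 := @slip_second_order y 0 0 1 e01; have h10 := @slip_second_order y 1 0 1 e01.
have h01 := @slip_second_order y 0 1 0 e10; have h11 := @slip_second_order y 1 1 0 e10.
have cc : (fun=> 2^-1) e @[e --> (0 : R)^'+] --> (2^-1 : R) by exact: cvg_cst.
have h := cvgB (cvgM cc (cvgD h00 h10)) (cvgM cc (cvgD h01 h11)).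
move: h; rewrite /= !thrust_straight !dird_turn_straight !dird_tilt !dird_drift_straight.
rewrite !dird_torque_straight !(rev_ord2_0, rev_ord2_1) /= -/A -/B -/K -/rho.
rewrite subrr cos0 => h; have FF : Filter (0 : R)^'+ by exact: _.
have {h} := h FF FF FF FF FF.
set l := (X in _ --> X).
have -> : l = sin (theta0 + pi / 2 - zeta) / 2 *
    ((rho - L / 2) * (K * lam) * (A + B) + rho * A * (K * lam + K * lam ^+ 2)) *
    (y 1 ^+ 2 - y 0 ^+ 2) by rewrite /l; field.
move=> h; apply: cvg_trans h; apply: near_eq_cvg; apply: nearW => eps.
rewrite /midpoint_curl !mr /= !fctE.
by rewrite mulrBl -!mulrA !mulrDl.
Qed.

End SmallAmplitude.

(** * Short loops *)

Section LoopLimit.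
Variables (R : realType).
Implicit Types (a b tau t M : R).

(** Each of the four legs changes [f] by at most [(a + b) * M * tau]. *)
Lemma follows_loop_bound a b tau f (c : 'I_2 -> R -> R) M t :
  0 <= a -> 0 <= b -> 0 < tau -> follows_loop a b tau f c ->
  (forall j s, 0 < s < 4 * tau -> `|c j s| <= M) ->
  0 <= t <= 4 * tau -> `|f t - f 0| <= 4 * (a + b) * M * tau.
Proof.
move=> a0 b0 tau0.
have [s1 s2 s3] : [/\ 0 <= tau, 0 <= 2 * tau & 0 <= 3 * tau] by split; lra.
have [q1 q2 q3] : [/\ tau <= 4 * tau, 2 * tau <= 4 * tau & 3 * tau <= 4 * tau].
  by split; lra.
have [r1 r2 r3] : [/\ tau <= 2 * tau, 2 * tau <= 3 * tau & 3 * tau <= 4 * tau].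
  by split; lra.
have [d1 d2 d3] : [/\ 2 * tau - tau = tau, 3 * tau - 2 * tau = tau & 4 * tau - 3 * tau = tau].
  by split; ring.
move=> [cf [f1 f2 f3 f4]] hc.
have M0 : 0 <= M.
  apply: le_trans (normr_ge0 _) (hc 0 tau _); lra.
have step s s' u w j : 0 <= s -> s <= u <= s' -> s' <= 4 * tau -> s' - s = tau ->
    `|w| <= a + b ->
    (forall t, s < t < s' -> is_derive t 1 f (w * c j t)) ->
    `|f u - f s| <= (a + b) * M * tau.
  move=> h0 /andP[su us] s4 <- hw df.
  have cu : {within `[s, u], continuous f}.
    exact: (within_segment_sub h0 (le_trans us s4) cf).
  have du t' : s < t' < u -> is_derive t' 1 f (w * c j t').
    by move=> /andP[st tu]; apply: df; rewrite st (lt_le_trans tu).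
  have bu t' : s < t' < u -> `|w * c j t' - 0| <= (a + b) * M.
    move=> /andP[st tu]; rewrite subr0 normrM ler_pM// hc//.
    by rewrite (le_lt_trans h0 st) (lt_le_trans tu (le_trans us s4)).
  have := increment_bound su cu du bu; rewrite mul0r subr0 => /le_trans; apply.
  by rewrite ler_wpM2l ?mulr_ge0 ?addr_ge0// lerB.
have na : `|- a| <= a + b by rewrite normrN ger0_norm// lerDl.
have nb : `|- b| <= a + b by rewrite normrN ger0_norm// lerDr.
have pa : `|a| <= a + b by rewrite -normrN.
have pb : `|b| <= a + b by rewrite -normrN.
have g1 u : 0 <= u <= tau -> `|f u - f 0| <= (a + b) * M * tau.
  by move=> hu; apply: (step 0 tau u (- b) 1) => //; rewrite subr0.
have g2 u : tau <= u <= 2 * tau -> `|f u - f tau| <= (a + b) * M * tau.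
  by move=> hu; apply: (step tau (2 * tau) u (- a) 0).
have g3 u : 2 * tau <= u <= 3 * tau -> `|f u - f (2 * tau)| <= (a + b) * M * tau.
  by move=> hu; apply: (step (2 * tau) (3 * tau) u b 1).
have g4 u : 3 * tau <= u <= 4 * tau -> `|f u - f (3 * tau)| <= (a + b) * M * tau.
  by move=> hu; apply: (step (3 * tau) (4 * tau) u a 0).
have h1 : `|f tau - f 0| <= (a + b) * M * tau by apply: g1; rewrite s1 lexx.
have h2 : `|f (2 * tau) - f tau| <= (a + b) * M * tau by apply: g2; rewrite r1 lexx.
have h3 : `|f (3 * tau) - f (2 * tau)| <= (a + b) * M * tau by apply: g3; rewrite r2 lexx.
have -> : 4 * (a + b) * M * tau = 4 * ((a + b) * M * tau) by ring.
have K0 : 0 <= (a + b) * M * tau by rewrite !mulr_ge0 ?addr_ge0.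
move: ((a + b) * M * tau) K0 g1 g2 g3 g4 h1 h2 h3 => K K0 g1 g2 g3 g4 h1 h2 h3.
have tri (x y z : R) : `|x - z| <= `|x - y| + `|y - z| by exact: ler_distD.
have t2 := tri (f (2 * tau)) (f tau) (f 0).
have t3 := tri (f (3 * tau)) (f (2 * tau)) (f 0).
move=> /andP[t0 t4]; case: (leP t tau) => [tt1|/ltW tt1].
  have := g1 t; rewrite t0 tt1 => /(_ isT); clear -K0; lra.
case: (leP t (2 * tau)) => [tt2|/ltW tt2].
  have := g2 t; rewrite tt1 tt2 => /(_ isT) h; have := tri (f t) (f tau) (f 0).
  clear -K0 h h1; lra.
case: (leP t (3 * tau)) => [tt3|/ltW tt3].
  have := g3 t; rewrite tt2 tt3 => /(_ isT) h; have := tri (f t) (f (2 * tau)) (f 0).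
  clear -K0 h h1 h2 t2; lra.
have := g4 t; rewrite tt3 t4 => /(_ isT) h; have := tri (f t) (f (3 * tau)) (f 0).
clear -K0 h h1 h2 h3 t2 t3; lra.
Qed.

(* Convergence as the duration of a leg vanishes, uniformly over the loop.  *)
Definition loop_filter : set_system (R * R) :=
  [set A | \forall tau \near 0^'+, forall t, 0 <= t <= 4 * tau -> A (tau, t)].

Global Instance loop_filter_filter : Filter loop_filter.
Proof.
split.
- by apply: nearW.
- move=> A B hA hB; rewrite /loop_filter /=; near=> tau => t ht.
  by split; move: t ht; near: tau.
- move=> A B AB hA; rewrite /loop_filter /=; near=> tau => t ht.
  by apply: AB; move: t ht; near: tau.
Unshelve. all: by end_near.
Qed.

Variable J : Type.
Implicit Types (q : R -> J -> R) (V : 'I_2 -> (J -> R) -> J -> R).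

(** [C1] does not ask for linearity in the direction; homogeneity comes from the chain rule for [t]
    replaced by [r * t]. It extracts the signed amplitude of each leg. *)
Lemma dirdZ (g : (J -> R) -> R) (q0 v : J -> R) r : smooth g ->
  dird g q0 (fun x => r * v x) = r * dird g q0 v.
Proof.
move=> /smoothP sg; have [d1 _ _] := sg.
rewrite /dird [LHS]derive1E [X in _ = _ * X]derive1E.
have h s w : is_derive s (1 : R) (fun t => g (fun x => q0 x + t * w x))
    (dird g (fun x => q0 x + s * w x) w).
  apply: (d1 (fun t x => q0 x + t * w x)) => x.
  by apply: is_derive_eq; rewrite /GRing.scale /=; ring.
have h0 : is_derive (r * 0) (1 : R) (fun t => g (fun x => q0 x + t * v x))
    (dird g (fun x => q0 x + r * 0 * v x) v) by exact: h.
have hr : is_derive (0 : R) (1 : R) (fun t => r * t) r.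
  by apply: is_derive_eq; rewrite /GRing.scale /=; ring.
have := is_derive1_comp h0 hr; rewrite /comp /=.
rewrite (_ : (fun x => g _) = (fun t => g (fun x => q0 x + t * (r * v x)))); last first.
  by apply/funext => t; congr g; apply/funext => x; ring.
move=> h1; rewrite (derive_val (is_derive := h1)).
have := h 0 v => h2; rewrite (derive_val (is_derive := h2)) mulrC.
by rewrite mulr0.
Qed.

Lemma follows_loop_comp a b tau q V g : smooth g ->
  (forall x, follows_loop a b tau (fun t => q t x) (fun j t => V j (q t) x)) ->
  follows_loop a b tau (fun t => g (q t))
    (fun j t => dird g (q t) (V j (q t))).
Proof.
move=> sg hq; have [d1 d2 _] := smoothP sg; split.
  apply/subspace_continuousP => t ht; apply: d2 => x.
  by have [/subspace_continuousP /(_ t ht)] := hq x.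
by split=> t ht; rewrite -dirdZ//; apply: d1 => x; have [_ [h1 h2 h3 h4]] := hq x; eauto.
Qed.

(** The second-order rates are continuous in the configuration, so convergence along [loop_filter]
    supplies the uniform closeness that [loop_increment] needs. *)
Lemma loop_limit a b (q : R -> R -> J -> R) (q0 : J -> R) V (f : R -> R -> R)
    (c : 'I_2 -> (J -> R) -> R) :
  0 <= a -> 0 <= b -> (forall j, smooth (c j)) ->
  (forall k x, smooth (fun r : J -> R => V k r x)) ->
  (forall tau, 0 < tau -> forall x,
     follows_loop a b tau (fun t => q tau t x) (fun j t => V j (q tau t) x)) ->
  (forall tau, 0 < tau ->
     follows_loop a b tau (f tau) (fun j t => c j (q tau t))) ->
  (forall x, q p.1 p.2 x @[p --> loop_filter] --> q0 x) ->
  (f tau (4 * tau) - f tau 0) / tau ^+ 2 @[tau --> 0^'+] -->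
  a * b * (dird (c 0) q0 (V 1 q0) - dird (c 1) q0 (V 0 q0)).
Proof.
move=> a0 b0 sc sV hq hf cq.
have ce k j : dird (c k) (q p.1 p.2) (V j (q p.1 p.2)) @[p --> loop_filter]
    --> dird (c k) q0 (V j q0).
  have [_ _ d3] := smoothP (sc k); apply: d3 => // x.
  by have [_ d2 _] := smoothP (sV j x); exact: d2.
apply/cvgrPdist_le => eta eta0.
(* Absorbs the constant of [loop_increment]; the summand 1 keeps the denominator positive if
   [a = b = 0]. *)
pose e1 := eta / (3 * (a + b) ^+ 2 + 1).
have K0 : 0 < 3 * (a + b) ^+ 2 + 1 by have := sqr_ge0 (a + b); lra.
have e10 : 0 < e1 by rewrite divr_gt0.
have he k j : \forall tau \near 0^'+, forall t, 0 <= t <= 4 * tau ->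
    `|dird (c k) q0 (V j q0) - dird (c k) (q tau t) (V j (q tau t))| <= e1.
  by have /cvgrPdist_le /(_ _ e10) := ce k j.
near=> tau.
have tau0 : 0 < tau by near: tau; exact: nbhs_right_gt.
have bnd k j t : 0 <= t <= 4 * tau ->
    `|dird (c k) (q tau t) (V j (q tau t)) - dird (c k) q0 (V j q0)| <= e1.
  rewrite distrC; move: t; move: k j.
  by near: tau; apply: filter_forall => k; apply: filter_forall => j; exact: he.
have := loop_increment a0 b0 tau0 (hf _ tau0)
  (fun k => follows_loop_comp (sc k) (hq _ tau0)) bnd.
set D := a * b * _; set F := f tau (4 * tau) - _.
move=> h; rewrite distrC.
have -> : F / tau ^+ 2 - D = (F - D * tau ^+ 2) / tau ^+ 2.
  by field; rewrite gt_eqF.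
rewrite normrM normfV (ger0_norm (sqr_ge0 tau)) ler_pdivrMr ?exprn_gt0//.
apply: le_trans h _; rewrite ler_wpM2r ?sqr_ge0//.
rewrite /e1 mulrA ler_pdivrMr// mulrC ler_wpM2l ?ltW//.
by rewrite ltrDl.
Unshelve. all: by end_near.
Qed.

End LoopLimit.

(** * Trajectories *)

Lemma control_legs (R : realType) (g1 g2 tau : R) : 0 < tau ->
  [/\ forall t, 0 < t < tau -> control1 g1 tau t = 0 /\ control2 g2 tau t = - g2,
    forall t, tau < t < 2 * tau -> control1 g1 tau t = - g1 /\ control2 g2 tau t = 0,
    forall t, 2 * tau < t < 3 * tau -> control1 g1 tau t = 0 /\ control2 g2 tau t = g2
  & forall t, 3 * tau < t < 4 * tau -> control1 g1 tau t = g1 /\ control2 g2 tau t = 0].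
Proof.
move=> tau0; rewrite /control1 /control2; split=> t /andP[h1 h2].
- have e1 : (tau <= t) = false by apply/negbTE; rewrite -ltNge.
  have e2 : (3 * tau <= t) = false by apply/negbTE; rewrite -ltNge; lra.
  by rewrite e1 e2 h2 (ltW h1).
- have e1 : (t < tau) = false by apply/negbTE; rewrite -leNgt ltW.
  have e2 : (2 * tau <= t) = false by apply/negbTE; rewrite -ltNge.
  by rewrite e1 e2 h2 (ltW h1) andbF.
- have e1 : (t < tau) = false by apply/negbTE; rewrite -leNgt; lra.
  have e2 : (3 * tau <= t) = false by apply/negbTE; rewrite -ltNge.
  have e3 : (t < 2 * tau) = false by apply/negbTE; rewrite -leNgt ltW.
  by rewrite e1 e2 e3 h2 (ltW h1) !andbF.
- have e1 : (t < tau) = false by apply/negbTE; rewrite -leNgt; lra.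
  have e2 : (t < 2 * tau) = false by apply/negbTE; rewrite -leNgt; lra.
  have e3 : (t < 3 * tau) = false by apply/negbTE; rewrite -leNgt ltW.
  by rewrite e1 e2 e3 h2 (ltW h1) !andbF.
Qed.

Lemma loop_times (R : realType) (tau t : R) : 0 < tau ->
  [|| 0 < t < tau, tau < t < 2 * tau, 2 * tau < t < 3 * tau | 3 * tau < t < 4 * tau] ->
  [/\ 0 < t < 4 * tau, t != tau, t != 2 * tau & t != 3 * tau].
Proof. by move=> tau0 /or4P[] ht; split; lra. Qed.

(** * Continuity and derivatives of linear functionals *)

Section LinearFunctional.
Variables (R : realType) (n : nat) (l : 'cV[R]_n -> R).
Hypothesis ll : forall a u v, l (a *: u + v) = a * l u + l v.

Lemma functional_coord (u : 'cV[R]_n) : l u = \sum_i u i 0 * l (delta_mx i 0).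
Proof.
have l0 : l 0 = 0.
  have := ll 1 0 0; rewrite scaler0 addr0 mul1r => /eqP.
  by rewrite addrC -subr_eq subrr eq_sym => /eqP.
rewrite {1}[u]matrix_sum_delta.
under eq_bigr do rewrite big_ord1.
elim/big_rec2: _ => [|i x y _ <-]; first by [].
by rewrite ll.
Qed.

Lemma functional_continuous : continuous l.
Proof.
have -> : l = fun u => \sum_i (fun i u => u i 0 * l (delta_mx i 0)) i u.
  by apply/funext => u; exact: functional_coord.
move=> u; have FF : Filter (nbhs u) := @nbhs_filter 'cV[R]_n u.
apply: cvg_big => [|i _]; first exact: add_continuous.
by apply: cvgM; [exact: coord_continuous|exact: cvg_cst].
Qed.

Lemma functional_is_derive (y : R -> 'cV[R]_n) (t : R) (dy : 'cV[R]_n) :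
  is_derive t 1 y dy -> is_derive t 1 (fun s => l (y s)) (l dy).
Proof.
move=> [dy1 dy2].
have dc i : is_derive t 1 (fun s => y s i 0 * l (delta_mx i 0))
    (dy i 0 * l (delta_mx i 0)).
  have h : is_derive t 1 (fun s => y s i 0) (dy i 0).
    split; first by move/derivable_mxP : dy1.
    by rewrite -dy2 derive_mx// mxE.
  apply: (is_derive_eq (is_deriveM h (is_derive_cst (l (delta_mx i 0)) t 1))).
  by rewrite /GRing.scale /= mulr0 add0r mulrC.
have := is_derive_sum dc.
rewrite functional_coord (_ : \sum_(i < n) (fun s => _) = fun s => l (y s))//.
by apply/funext => s; rewrite fct_sumE functional_coord.
Qed.

End LinearFunctional.

Section State.
Variable R : realType.
Implicit Types (s : state R) (i : 'I_2).

(** The inverse of the change of coordinates given by [base_angle] and [open_angle]. *)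
Definition config s (x : 'I_2 + 'I_2) : R :=
  match x with inl i => orientation s i + opening s i / 2 | inr i => opening s i / 2 end.

Lemma base_config s : base_angle (config s) = orientation s.
Proof. by apply/funext => i; rewrite /base_angle /= addrK. Qed.

Lemma open_config s : open_angle (config s) = opening s.
Proof. by apply/funext => i; rewrite /open_angle /=; field. Qed.

Definition midpoint_coord (zeta : R) s : R :=
  dot (frame zeta 1 0) (2^-1 *: (hinge s 0 + hinge s 1)).

Lemma config_linear x a s s' : config (a *: s + s') x = a * config s x + config s' x.
Proof.
by case: x => i /=; rewrite /orientation /opening /scallop; [case: ifP => _|]; rewrite !mxE; field.
Qed.

Lemma midpoint_coord_linear zeta a s s' :
  midpoint_coord zeta (a *: s + s') = a * midpoint_coord zeta s + midpoint_coord zeta s'.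
Proof. by rewrite /midpoint_coord /hinge /scallop !dotE /= !mxE; field. Qed.

End State.

Section Trajectory.
Variables (R : realType) (L Cpar Cperp lam gamma1 gamma2 theta0 : R).
Variables (x1o x2o : 'cV[R]_2).
Hypotheses (hL : 0 < L) (hCpar : 0 < Cpar) (hCperp : 0 < Cperp).
Hypothesis hinv : forall theta sigma : 'I_2 -> R,
  resistance L Cpar Cperp lam theta sigma \in unitmx.
Implicit Types (q : 'I_2 + 'I_2 -> R) (u : 'I_2 -> R) (tau : R).

Definition state_rate q u : state R :=
  let dh i := u i / 2 in
  col_mx (body_velocity L Cpar Cperp q (rotation L Cpar Cperp lam q dh) dh)
         (\col_i u i).

Lemma velocityE tau t s : velocity L Cpar Cperp lam gamma1 gamma2 tau t s
  = state_rate (config s)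
      (fun i => if i == 0 then control1 gamma1 tau t else control2 gamma2 tau t).
Proof.
rewrite /velocity -base_config -open_config.
exact: (control_fieldE hL hCpar hCperp hinv (config s)
  (fun i => if i == 0 then control1 gamma1 tau t else control2 gamma2 tau t)).
Qed.

Lemma config_rate q u x : config (state_rate q u) x
  = u 0 / 2 * shape_field L Cpar Cperp lam 0 q x
    + u 1 / 2 * shape_field L Cpar Cperp lam 1 q x.
Proof.
have open_rate i : opening (state_rate q u) i = u i.
  by rewrite /opening col_mxKd mxE.
have orient_rate i : orientation (state_rate q u) i
    = rotation L Cpar Cperp lam q (fun i => u i / 2) i - u i / 2.
  move: i; apply: ord2P; rewrite /orientation /scallop /= /body_velocity.
    by rewrite !(col_mxKu, col_mxKd) mxE mulr1n.
  by rewrite !(col_mxKu, col_mxKd) mxE mulr1n.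
case: x => i /=; rewrite open_rate ?orient_rate; first by rewrite /rotation; field.
by move: i; apply: ord2P => /=; field.
Qed.

Lemma midpoint_coord_rate zeta q u : midpoint_coord zeta (state_rate q u)
  = u 0 / 2 * midpoint_rate L Cpar Cperp lam zeta 0 q
    + u 1 / 2 * midpoint_rate L Cpar Cperp lam zeta 1 q.
Proof.
rewrite /midpoint_coord /hinge /scallop /state_rate /body_velocity /=.
rewrite !(col_mxKu, col_mxKd) dotC dotZl dotDl /hinge_velocity !dot_frame.
rewrite /midpoint_rate /slip /rotation /= -!(opprB _ zeta) !cosN !sinN.
by field.
Qed.

(** Used for the configuration coordinates and for the projections of the midpoint, all linear in
    the state. *)
Lemma solution_follows_loop phi eps tau (y : R -> state R)
    (l : state R -> R) (c : 'I_2 -> ('I_2 + 'I_2 -> R) -> R) :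
  0 < tau ->
  is_solution L Cpar Cperp lam gamma1 gamma2 theta0 x1o x2o phi eps tau y ->
  (forall a (s s' : state R), l (a *: s + s') = a * l s + l s') ->
  (forall q u, l (state_rate q u) = u 0 / 2 * c 0 q + u 1 / 2 * c 1 q) ->
  follows_loop (gamma1 / 2) (gamma2 / 2) tau (fun t => l (y t))
    (fun j t => c j (config (y t))).
Proof.
move=> tau0 [_ cy dy] ll lc.
have dl t : 0 < t < 4 * tau -> t != tau -> t != 2 * tau -> t != 3 * tau ->
    is_derive t 1 (fun t => l (y t))
      (control1 gamma1 tau t / 2 * c 0 (config (y t))
       + control2 gamma2 tau t / 2 * c 1 (config (y t))).
  move=> t1 t2 t3 t4; have := functional_is_derive ll (dy t t1 t2 t3 t4).
  by rewrite velocityE lc.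
split.
  apply/subspace_continuousP => t ht.
  have /subspace_continuousP /(_ t ht) cyt := cy.
  have lt : l s @[s --> y t] --> l (y t) by exact: functional_continuous.
  exact: (cvg_comp _ _ cyt lt).
have [u1 u2 u3 u4] := control_legs gamma1 gamma2 tau0.
split=> t ht; (apply: is_derive_eq; [apply: dl|]).
all: try by have [-> ->] := u1 t ht; field.
all: try by have [-> ->] := u2 t ht; field.
all: try by have [-> ->] := u3 t ht; field.
all: try by have [-> ->] := u4 t ht; field.
all: by have [] := loop_times tau0 (t := t); rewrite ?ht ?orbT.
Qed.

End Trajectory.

(** The openings exceed [pi] by [eps] and [eps * cos phi]; configurations record half openings. *)
Definition initial_spread (R : realType) (phi : R) (i : 'I_2) : R :=
  if i == 0 then 1 / 2 else cos phi / 2.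

(** * Bounds and convergence uniform over short loops *)

Section Uniform.
Variables (R : realType) (L Cpar Cperp lam gamma1 gamma2 theta0 : R).
Variables (x1o x2o : 'cV[R]_2).
Hypotheses (hL : 0 < L) (hCpar : 0 < Cpar) (hCperp : 0 < Cperp).
Hypotheses (hgamma1 : 0 < gamma1) (hgamma2 : 0 < gamma2).
Hypothesis hinv : forall theta sigma : 'I_2 -> R,
  resistance L Cpar Cperp lam theta sigma \in unitmx.
Implicit Types (q : 'I_2 + 'I_2 -> R) (tau : R).

Local Notation turn := (turn L Cpar Cperp lam).

(** With [tilt] factored out, the axes enter [turn] only through [coupling], where the cosine of
    their difference is even. *)
Lemma turn_cos q q' : (forall i, q (inr i) = q' (inr i)) ->
  cos (q (inl 1) - q (inl 0)) = cos (q' (inl 1) - q' (inl 0)) ->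
  forall i j, turn q i j = turn q' i j.
Proof.
move=> E C i j.
have Et k : thrust L Cpar Cperp q k = thrust L Cpar Cperp q' k.
  by rewrite /thrust /axial_drag E.
have Ed k : drift L Cpar Cperp q k = drift L Cpar Cperp q' k.
  by rewrite /drift /side_drag E.
have Ei k : inertia L Cpar Cperp q k = inertia L Cpar Cperp q' k.
  by rewrite /inertia Ed E.
have Eq k : torque L Cpar Cperp q k = torque L Cpar Cperp q' k.
  by rewrite /torque Et !E.
have Ec k : coupling L Cpar Cperp q k = coupling L Cpar Cperp q' k.
  move: k; apply: ord2P; rewrite /coupling !Ed !E !(rev_ord2_0, rev_ord2_1) ?C//.
  by rewrite -[q (inl 0) - _]opprB cosN C -cosN opprB.
by rewrite /turn /torque_det !(Ei, Eq, Ec).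
Qed.

(* The rates depend on the directions of the axes only through
   [cos (q (inl 1) - q (inl 0))], so that their difference can be taken in
   [[0, pi]], which is compact.  *)
Lemma turn_bounded (h : 'I_2 -> R) : exists M : R, forall q,
  (forall i, `|q (inr i) - h i| <= 1) -> forall i j, `|turn q i j| <= M.
Proof.
pose Q (d : R * (R * R)) (x : 'I_2 + 'I_2) : R :=
  match x with inl i => if i == 0 then 0 else d.1
             | inr i => if i == 0 then d.2.1 else d.2.2 end.
pose K : set (R * (R * R)) :=
  `[0, pi] `*` (`[h 0 - 1, h 0 + 1] `*` `[h 1 - 1, h 1 + 1]).
have cK : compact K.
  by apply: compact_setX; [|apply: compact_setX]; exact: segment_compact.
have bnd i j : exists M : R, forall d, K d -> `|turn (Q d) i j| <= M.
  have ct : continuous (fun d => turn (Q d) i j).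
    move=> d; have [_ sc _] := smoothP (smooth_turn hL hCpar hCperp hinv i j).
    apply: sc => -[k|k] /=; case: ifP => _.
    - exact: cvg_cst.
    - exact: cvg_fst.
    - by apply: cvg_comp; [exact: cvg_snd|exact: cvg_fst].
    - by apply: cvg_comp; [exact: cvg_snd|exact: cvg_snd].
  have /compact_bounded[M [_ hM]] := continuous_compact (continuous_subspaceT ct) cK.
  (* Boundedness provides every constant strictly above [M]. *)
  exists (M + 1) => d Kd; apply: (hM (M + 1)); first by rewrite ltrDl.
  by exists d.
have [M00 h00] := bnd 0 0; have [M01 h01] := bnd 0 1.
have [M10 h10] := bnd 1 0; have [M11 h11] := bnd 1 1.
exists (`|M00| + `|M01| + `|M10| + `|M11|) => q hq.
(* The arccosine selects the angle in [[0, pi]] with the same cosine, so [Q d] has the same [turn]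
   as [q]. *)
pose d := (acos (cos (q (inl 1) - q (inl 0))), (q (inr 0), q (inr 1))).
have cd : -1 <= cos (q (inl 1) - q (inl 0)) <= 1 by rewrite cos_geN1 cos_le1.
have [ad cad] := acos_def cd.
have Kd : K d.
  split; first by rewrite /= in_itv.
  by split; rewrite /= in_itv /=; [have := hq 0|have := hq 1]; rewrite ler_norml; lra.
have qd := @turn_cos q (Q d) (ord2P erefl erefl) _.
have {}qd i j : turn q i j = turn (Q d) i j by apply: qd; rewrite /= subr0 cad.
have := ler_norm M00; have := ler_norm M01; have := ler_norm M10; have := ler_norm M11.
have := normr_ge0 M00; have := normr_ge0 M01; have := normr_ge0 M10; have := normr_ge0 M11.
move: (h00 _ Kd) (h01 _ Kd) (h10 _ Kd) (h11 _ Kd); rewrite -!qd => b00 b01 b10 b11.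
move=> n1 n2 n3 n4 m1 m2 m3 m4.
by apply: ord2P; apply: ord2P;
  [apply: (le_trans b00)|apply: (le_trans b01)|apply: (le_trans b10)|apply: (le_trans b11)]; lra.
Qed.

Variables (phi eps : R) (y : R -> R -> state R).
Hypothesis hy : forall tau, 0 < tau ->
  is_solution L Cpar Cperp lam gamma1 gamma2 theta0 x1o x2o phi eps tau (y tau).

Lemma config_follows_loop tau x : 0 < tau ->
  follows_loop (gamma1 / 2) (gamma2 / 2) tau (fun t => config (y tau t) x)
    (fun j t => shape_field L Cpar Cperp lam j (config (y tau t)) x).
Proof.
move=> tau0.
apply: (solution_follows_loop hL hCpar hCperp hinv (l := fun s => config s x)
  (c := fun j q => shape_field L Cpar Cperp lam j q x) tau0 (hy tau0)).
- by move=> a s s'; exact: config_linear.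
- by move=> q u; exact: config_rate.
Qed.

Lemma midpoint_coord_follows_loop zeta tau : 0 < tau ->
  follows_loop (gamma1 / 2) (gamma2 / 2) tau
    (fun t => midpoint_coord zeta (y tau t))
    (fun j t => midpoint_rate L Cpar Cperp lam zeta j (config (y tau t))).
Proof.
move=> tau0.
apply: (solution_follows_loop hL hCpar hCperp hinv (l := midpoint_coord zeta)
  (c := midpoint_rate L Cpar Cperp lam zeta) tau0 (hy tau0)).
- by move=> a s s'; exact: midpoint_coord_linear.
- by move=> q u; exact: midpoint_coord_rate.
Qed.

Lemma config0 tau : 0 < tau -> config (y tau 0) = bent theta0 (initial_spread phi) eps.
Proof.
move=> /hy[-> _ _]; apply/funext; rewrite /mk_state /bent /initial_spread.
have o i : opening (col_mx (col_mx (col_mx x1o theta0%:M) (col_mx x2o theta0%:M))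
    (col_mx (pi + eps)%:M (pi + eps * cos phi)%:M)) i
    = if i == 0 then pi + eps else pi + eps * cos phi.
  rewrite /opening col_mxKd; move: i; apply: ord2P => /=.
    by rewrite mxE; case: splitP => j; rewrite ord1 // mxE.
  by rewrite mxE; case: splitP => j; rewrite ord1 // mxE.
have r i : orientation (col_mx (col_mx (col_mx x1o theta0%:M) (col_mx x2o theta0%:M))
    (col_mx (pi + eps)%:M (pi + eps * cos phi)%:M)) i = theta0.
  rewrite /orientation /scallop; move: i.
  by apply: ord2P; rewrite /= !(col_mxKu, col_mxKd) mxE.
by case=> i /=; rewrite o ?r; case: ifP => _; field.
Qed.

(** The half openings have rates at most 1 per unit of control, so on short loops they stay within 1
    of their initial values. There [turn] is bounded by [M], and since [tilt] is a sine this bounds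
    the rates of the axes, independently of [tau]. *)
Lemma config_cvg x : config (y p.1 p.2) x @[p --> @loop_filter R]
  --> bent theta0 (initial_spread phi) eps x.
Proof.
set q0 := bent _ _ _.
have [M hM] := turn_bounded (fun i => q0 (inr i)).
have M0 : 0 <= M.
  by apply: le_trans (normr_ge0 _) (hM q0 _ 0 0) => i; rewrite subrr normr0 ler01.
have a0 : 0 <= gamma1 / 2 by rewrite divr_ge0// ltW.
have b0 : 0 <= gamma2 / 2 by rewrite divr_ge0// ltW.
set K := 4 * (gamma1 / 2 + gamma2 / 2).
have K0 : 0 <= K by rewrite mulr_ge0// addr_ge0.
have K1 : 0 < K + 1 by rewrite ltr_wpDl.
have KM1 : 0 < K * (M + 1) + 1 by rewrite ltr_wpDl// mulr_ge0// addr_ge0.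
apply/cvgrPdist_le => eta eta0.
change (\forall tau \near 0^'+, forall t, 0 <= t <= 4 * tau ->
  `|q0 x - config (y tau t) x| <= eta).
near=> tau => t ht.
have tau0 : 0 < tau by near: tau; exact: nbhs_right_gt.
have q0E : q0 = config (y tau 0) by rewrite config0.
have small1 : K * tau <= 1.
  have h : tau <= (K + 1)^-1 by near: tau; apply: nbhs_right_le; rewrite invr_gt0.
  apply: (@le_trans _ _ ((K + 1) * tau)); first by rewrite ler_wpM2r ?lerDl// ltW.
  by rewrite mulrC -ler_pdivlMr// div1r.
have small2 : K * (M + 1) * tau <= eta.
  have h : tau <= eta / (K * (M + 1) + 1).
    by near: tau; apply: nbhs_right_le; rewrite divr_gt0.
  apply: (@le_trans _ _ ((K * (M + 1) + 1) * tau)).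
    by rewrite ler_wpM2r ?lerDl// ltW.
  by rewrite mulrC -ler_pdivlMr.
have open1 s i : 0 <= s <= 4 * tau -> `|config (y tau s) (inr i) - q0 (inr i)| <= K * 1 * tau.
  move=> hs; rewrite q0E.
  apply: (follows_loop_bound a0 b0 tau0 (config_follows_loop (inr i) tau0) _ hs).
  by move=> j s' _ /=; rewrite ger0_norm ?ler_nat ?ler0n//; case: (i == j).
have axis1 i : `|config (y tau t) (inl i) - q0 (inl i)| <= K * M * tau.
  rewrite q0E.
  apply: (follows_loop_bound a0 b0 tau0 (config_follows_loop (inl i) tau0) _ ht).
  move=> j s /andP[s0 s4] /=; rewrite normrM -[M]mul1r ler_pM//.
    by rewrite /tilt ler_norml sin_geN1 sin_le1.
  apply: hM => k; apply: le_trans (open1 s k _) _; first by rewrite !ltW.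
  by rewrite mulr1.
rewrite distrC; case: x => i.
  apply: le_trans (axis1 i) (le_trans _ small2).
  by rewrite ler_wpM2r ?ler_wpM2l// ?lerDl// ltW.
apply: le_trans (open1 t i ht) (le_trans _ small2).
by rewrite ler_wpM2r ?ler_wpM2l// ?lerDr// ltW.
Unshelve. all: by end_near.
Qed.

Lemma midpoint_coord_limit zeta :
  (midpoint_coord zeta (y tau (4 * tau)) - midpoint_coord zeta (y tau 0)) / tau ^+ 2
    @[tau --> 0^'+] -->
  gamma1 / 2 * (gamma2 / 2) *
    midpoint_curl L Cpar Cperp lam zeta (bent theta0 (initial_spread phi) eps).
Proof.
have := @loop_limit R _ (gamma1 / 2) (gamma2 / 2) (fun tau t => config (y tau t))
  (bent theta0 (initial_spread phi) eps) (shape_field L Cpar Cperp lam)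
  (fun tau t => midpoint_coord zeta (y tau t)) (midpoint_rate L Cpar Cperp lam zeta).
apply.
- by rewrite divr_ge0// ltW.
- by rewrite divr_ge0// ltW.
- by move=> j; exact: smooth_midpoint_rate.
- by move=> k x; exact: smooth_shape_field.
- by move=> tau tau0 x; exact: config_follows_loop.
- by move=> tau tau0; exact: midpoint_coord_follows_loop.
- exact: config_cvg.
Qed.

End Uniform.

(** * Displacement of the midpoint *)

Section Displacement.
Variable R : realType.

Lemma midpoint_coord_axis1 (s : state R) :
  midpoint_coord 0 s = (2^-1 *: (hinge s 0 + hinge s 1)) 0 0.
Proof. by rewrite /midpoint_coord dotE !mxE /= cos0 sin0; ring. Qed.

Lemma midpoint_coord_axis2 (s : state R) :
  midpoint_coord (pi / 2) s = (2^-1 *: (hinge s 0 + hinge s 1)) 1 0.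
Proof. by rewrite /midpoint_coord dotE !mxE /= cos_pihalf sin_pihalf; ring. Qed.

Lemma midpoint_displacementE (x1o x2o : 'cV[R]_2) theta0 sigma1 sigma2 tau
    (y : R -> state R) :
  y 0 = mk_state x1o theta0 x2o theta0 sigma1 sigma2 ->
  midpoint_displacement x1o x2o tau y
  = Num.sqrt ((midpoint_coord 0 (y (4 * tau)) - midpoint_coord 0 (y 0)) ^+ 2
     + (midpoint_coord (pi / 2) (y (4 * tau)) - midpoint_coord (pi / 2) (y 0)) ^+ 2).
Proof.
move=> y0; rewrite /midpoint_displacement /enorm dotE !midpoint_coord_axis1 !midpoint_coord_axis2.
have h0 : hinge (y 0) 0 = x1o.
  by rewrite y0 /mk_state /hinge /scallop /= !col_mxKu.
have h1 : hinge (y 0) 1 = x2o.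
  by rewrite y0 /mk_state /hinge /scallop /= !(col_mxKu, col_mxKd).
by rewrite h0 h1 !mxE !expr2.
Qed.

Lemma sqrt_scale (r a b : R) : 0 < r ->
  Num.sqrt (a ^+ 2 + b ^+ 2) / r = Num.sqrt ((a / r) ^+ 2 + (b / r) ^+ 2).
Proof.
move=> r0; have -> : (a / r) ^+ 2 + (b / r) ^+ 2 = (a ^+ 2 + b ^+ 2) * r^-1 ^+ 2 by ring.
by rewrite sqrtrM ?addr_ge0 ?sqr_ge0// sqrtr_sqr ger0_norm// invr_ge0 ltW.
Qed.

Lemma cvg_sqrt_sum (F : set_system R) {FF : Filter F} (f g : R -> R) (a b : R) :
  f x @[x --> F] --> a -> g x @[x --> F] --> b ->
  Num.sqrt (f x ^+ 2 + g x ^+ 2) @[x --> F] --> Num.sqrt (a ^+ 2 + b ^+ 2).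
Proof.
move=> fa gb; apply: continuous_cvg; first exact: sqrt_continuous.
by apply: cvgD; apply: cvgM.
Qed.

End Displacement.

Unset Implicit Arguments.

Theorem theorem2 (R : realType) (L Cpar Cperp gamma1 gamma2 theta0 lam : R)
    (x1o x2o : 'cV[R]_2) (z : R -> R -> R -> R -> state R)
    (hL : 0 < L) (hCpar : 0 < Cpar) (hCperp : 0 < Cperp)
    (hgamma1 : 0 < gamma1) (hgamma2 : 0 < gamma2)
    (htheta0 : 0 <= theta0 < 2 * pi) (hlam : 0 < lam < 1)
    (hinv : forall theta sigma : 'I_2 -> R,
        resistance L Cpar Cperp lam theta sigma \in unitmx)
    (hz : forall phi eps tau : R, 0 < eps -> 0 < tau ->
        is_solution L Cpar Cperp lam gamma1 gamma2 theta0 x1o x2o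
          phi eps tau (z phi eps tau)) :
  [/\ forall phi eps : R, 0 < eps ->
        cvg (scaled_displacement x1o x2o z phi eps tau @[tau --> 0^'+]),
      forall phi : R,
        cvg (small_time_limit x1o x2o z phi eps @[eps --> 0^'+])
    & forall phi : R,
        displacement_coefficient x1o x2o z phi
        <= displacement_coefficient x1o x2o z (pi / 2)].
Proof.
pose k := gamma1 / 2 * (gamma2 / 2).
pose E zeta phi eps := k * midpoint_curl L Cpar Cperp lam zeta
  (bent theta0 (initial_spread phi) eps).
have small_time phi eps : 0 < eps ->
    scaled_displacement x1o x2o z phi eps tau @[tau --> 0^'+] -->
    Num.sqrt ((E 0 phi eps / eps ^+ 2) ^+ 2 + (E (pi / 2) phi eps / eps ^+ 2) ^+ 2).
  move=> eps0.
  have lim zeta := midpoint_coord_limit hL hCpar hCperp hgamma1 hgamma2 hinv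
    (fun tau => hz phi eps tau eps0) zeta.
  rewrite -sqrt_scale ?exprn_gt0//.
  apply: (@cvg_trans _ _ _ _ _ (cvgM (cvg_sqrt_sum (lim 0) (lim (pi / 2))) (cvg_cst _))).
  apply: near_eq_cvg; near=> tau.
  have tau0 : 0 < tau by near: tau; exact: nbhs_right_gt.
  rewrite /scaled_displacement.
  have [y0 _ _] := hz phi eps tau eps0 tau0.
  rewrite (midpoint_displacementE _ y0) /= -sqrt_scale ?exprn_gt0//.
  by rewrite -mulrA -invfM [eps ^+ 2 * _]mulrC.
have small_timeE phi eps : 0 < eps -> small_time_limit x1o x2o z phi eps
    = Num.sqrt ((E 0 phi eps / eps ^+ 2) ^+ 2 + (E (pi / 2) phi eps / eps ^+ 2) ^+ 2).
  by move=> eps0; apply/cvg_lim => //; exact: small_time.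
(* One constant for each coordinate of the midpoint, both independent of [phi]. *)
have [C0 hC0] := midpoint_curl_second_order theta0 0 hL hCpar hCperp hinv.
have [C1 hC1] := midpoint_curl_second_order theta0 (pi / 2) hL hCpar hCperp hinv.
pose D phi := Num.sqrt ((k * (C0 * ((cos phi / 2) ^+ 2 - (1 / 2) ^+ 2))) ^+ 2
   + (k * (C1 * ((cos phi / 2) ^+ 2 - (1 / 2) ^+ 2))) ^+ 2).
have amplitude phi : small_time_limit x1o x2o z phi eps @[eps --> 0^'+] --> D phi.
  have h0 : E 0 phi eps / eps ^+ 2 @[eps --> 0^'+] -->
      k * (C0 * ((cos phi / 2) ^+ 2 - (1 / 2) ^+ 2)).
    rewrite /E; under eq_fun do rewrite -mulrA.
    by apply: cvgM; [exact: cvg_cst|exact: hC0].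
  have h1 : E (pi / 2) phi eps / eps ^+ 2 @[eps --> 0^'+] -->
      k * (C1 * ((cos phi / 2) ^+ 2 - (1 / 2) ^+ 2)).
    rewrite /E; under eq_fun do rewrite -mulrA.
    by apply: cvgM; [exact: cvg_cst|exact: hC1].
  apply: cvg_trans (cvg_sqrt_sum h0 h1); apply: near_eq_cvg; near=> eps.
  by rewrite small_timeE//; near: eps; exact: nbhs_right_gt.
have coefficientE phi : displacement_coefficient x1o x2o z phi = D phi.
  by apply/cvg_lim => //; exact: amplitude.
split=> [phi eps eps0|phi|phi].
- by apply/cvg_ex; eexists; exact: small_time.
- by apply/cvg_ex; eexists; exact: amplitude.
rewrite !coefficientE /D cos_pihalf ler_sqrt; last by rewrite addr_ge0 ?sqr_ge0.
(* Both sides are [(k * C / 4) ^+ 2] times the fourth power of a sine, that of [phi] on the left and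
   1 on the right. *)
have key C : (k * (C * ((cos phi / 2) ^+ 2 - (1 / 2) ^+ 2))) ^+ 2
    <= (k * (C * ((0 / 2) ^+ 2 - (1 / 2) ^+ 2))) ^+ 2.
  have -> : (k * (C * ((cos phi / 2) ^+ 2 - (1 / 2) ^+ 2))) ^+ 2
    = (k * C / 4) ^+ 2 * (1 - cos phi ^+ 2) ^+ 2 by field.
  have -> : (k * (C * ((0 / 2) ^+ 2 - (1 / 2) ^+ 2))) ^+ 2 = (k * C / 4) ^+ 2 * 1 by field.
  apply: ler_wpM2l; first exact: sqr_ge0.
  by apply: exprn_ile1; [rewrite -sin2cos2 sqr_ge0|rewrite gerBl sqr_ge0].
exact: lerD.
Unshelve. all: by end_near.
Qed.
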